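(* Let $n\ge 1$, let $\mathbf{G}$ be a ciliated bipartite ribbon graph in $\mathbb{R}^3$ and let $m$ be an $n$-multiweb in $\mathbf{G}$. Then the quantum trace $\mathbf{tr}_q(m)$ is a Laurent polynomial in $q^{1/n}$; that is, there is a Laurent polynomial $P_m(t)\in\mathbb{C}[t,t^{-1}]$ such that $\mathbf{tr}_q(m)=P_m(q^{1/n})$ for all admissible $q$ and all choices of $n$-th root $q^{1/n}$.
   Context: Parameters. $n\ge1$ is an integer. $q$ is an admissible parameter: a nonzero complex number which is not a $(2m)$-th root of unity for $m=2,\dots,n$, except that $q=\pm1$ is allowed; an $n$-th root $q^{1/n}$ is fixed. $[k]=\sum_{i=1}^k q^{-k-1+2i}$, $[0]=0$, $[k]!=[k][k-1]\cdots[1]$, $[0]!=1$ (so $[k]!\ne0$ for $k\le n$). Ribbon graphs. A bipartite ribbon graph $\mathbf{G}$ in $\mathbb{R}^3$ is a finite bipartite graph $G$ (vertex set $V=B\cup W$ of black and white vertices with $|B|=|W|=N$, edge set $E$, multiple edges allowed, edges oriented from black to white, at least one perfect matching) embedded in $\mathbb{R}^3$ together with a framing (a vector field along $G$ orthogonal to the edges, extending continuously to the vertices, near which the half-edges are coplanar and the framing is normal to this plane). Equivalently, it is an oriented surface made of black and white disks joined by rectangles. A ciliation is the choice, at each vertex, of a cilium on the boundary of the vertex disk away from the half-edges. It determines a linear order of the half-edges at the vertex: starting just after the cilium, counterclockwise at black vertices and clockwise at white vertices (seen from the tip of the framing vector). Everything is considered up to isotopy. By isotopy one may assume blackboard framing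 (framing constantly $(0,0,1)$), and then $\mathbf{G}$ is represented by a diagram in $\mathbb{R}^2$ with over/under information at crossings. Multiwebs. An $n$-multiweb $m$ in $\mathbf{G}$ is a function $m:E\to\{0,1,\dots,n\}$, $e\mapsto m_e$, such that $\sum_{e\ni v}m_e=n$ for every vertex $v$. Its split web $\mathbf{W}_m$ is the $n$-valent ciliated ribbon graph obtained by deleting the edges with $m_e=0$ and splitting (cutting lengthwise) each other edge ribbon into $m_e$ parallel copies; the cilia are kept, so no cilium lies between parallel copies. Quantum trace of an $n$-valent ciliated ribbon graph $\mathbf{W}$ (Sikora's Reshetikhin--Turaev invariant). Take a diagram of $\mathbf{W}$ with blackboard framing in generic position, such that at each black vertex the cilium points up (in the $y$-direction) and all $n$ half-edges leave downward, and at each white vertex the cilium points down and all $n$ half-edges arrive from above (so the linear order is left to right in both cases). Cut it by horizontal lines into strips each containing, besides vertical strands, at most one of the elementary pieces below. Let $V=\mathbb{C}^n$ with basis $x_1,\dots,x_n$ and dual basis $x_1^*,\dots,x_n^*$ of $V^*$. To a horizontal line associate the tensor product, from left to right, of a factor $V$ for each strand crossing it downward and $V^*$ for each strand crossing it upward ($\mathbb{C}$ if there is none). Each strip gives a linear map from the space of its lower line to the space of its upper line, namely the identity on vertical strands tensored with the map of the elementary piece: - crossing of two downward strands whose over-strand joins bottom left to top right: $R:V\otimes V\to V\otimes V$, where $R(x_i\otimes x_j)=q^{-1/n}x_j\otimes x_i$ if $i>j$, $q^{-1/n}\,q\,x_i\otimes x_i$ if $i=j$, and $q^{-1/n}(x_j\otimes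 x_i+(q-q^{-1})x_i\otimes x_j)$ if $i<j$; - crossing of two downward strands whose over-strand joins bottom right to top left: $R^{-1}$; - cup oriented from left to right: $1\mapsto\sum_i x_i\otimes x_i^*$; cup oriented from right to left: $1\mapsto\sum_i q^{n+1-2i}x_i^*\otimes x_i$; - cap oriented from left to right: $x_i^*\otimes x_j\mapsto\delta_{ij}$; cap oriented from right to left: $x_i\otimes x_j^*\mapsto q^{2i-n-1}\delta_{ij}$; - black vertex (half-edges below): $T_-:V^{\otimes n}\to\mathbb{C}$, $T_-(x_{i_1}\otimes\cdots\otimes x_{i_n})=(-q)^{\ell(\sigma)}$ if $\sigma=(i_1,\dots,i_n)$ is a permutation of $\{1,\dots,n\}$, and $0$ otherwise; - white vertex (half-edges above): $T_+:\mathbb{C}\to V^{\otimes n}$, $T_+(1)=\sum_{\sigma\in\mathfrak{S}_n}(-q)^{\ell(\sigma)}x_{\sigma(1)}\otimes\cdots\otimes x_{\sigma(n)}$. Here $\ell(\sigma)$ is the number of inversions. The composite of all strip maps is a linear map $\mathbb{C}\to\mathbb{C}$, i.e. multiplication by a scalar $\mathbf{tr}_q(\mathbf{W})$; by a theorem of Sikora it depends only on the isotopy class of $\mathbf{W}$. Quantum trace of a multiweb: $\displaystyle\mathbf{tr}_q(m)=\frac{\mathbf{tr}_q(\mathbf{W}_m)}{\prod_{e\in E}[m_e]!}$. *)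

(* Defs.v *)
From HB Require Import structures.
From mathcomp Require Import all_boot all_order all_algebra.
From mathcomp Require Import fingroup perm.
From mathcomp Require Import ring zify.

Set Implicit Arguments.
Unset Strict Implicit.
Unset Printing Implicit Defensive.

Import Order.TTheory GRing.Theory Num.Theory.

Local Open Scope ring_scope.

(* Ciliated ribbon graphs in R^3 (and their split webs) are represented by    *)
(* blackboard-framed diagrams in generic position, cut by horizontal lines.   *)
(* A diagram is the list of its strips FROM BOTTOM TO TOP.                    *)

(* A strip: vertical strands labelled by [lft], an elementary piece, and      *)
(* vertical strands labelled by [rgt].                                        *)
Record strip (S P : Type) := Strip { lft : seq S; piece : P; rgt : seq S }.

Definition lower (S P : Type) (src : P -> seq S) (s : strip S P) : seq S :=
  lft s ++ src (piece s) ++ rgt s.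
Definition upper (S P : Type) (tgt : P -> seq S) (s : strip S P) : seq S :=
  lft s ++ tgt (piece s) ++ rgt s.

(* The strips [ds] fit together, from the horizontal line [a] at the bottom   *)
(* to the horizontal line [b] at the top.                                     *)
Fixpoint stacked (S P : Type) (src tgt : P -> seq S) (a : seq S)
    (ds : seq (strip S P)) (b : seq S) : Prop :=
  if ds is s :: ds' then
    lower src s = a /\ stacked src tgt (upper tgt s) ds' b
  else a = b.

(* A strand crossing a horizontal line is recorded as [true] if it crosses    *)
(* it upward (tensor factor V^* ) and as [false] if downward (factor V).      *)
(*  Cross true  : crossing of two downward strands, the over-strand joining   *)
(*                bottom left to top right;                                   *)
(*  Cross false : same, the over-strand joining bottom right to top left;     *)
(*  Cup b, Cap b: oriented from left to right iff b = true.                   *)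
(* Vertices: black has its half-edges below and its cilium on top, white has  *)
(* its half-edges above and its cilium at the bottom.                         *)
Inductive web_piece :=
  | Cross of bool
  | Cup of bool
  | Cap of bool
  | BlackVertex
  | WhiteVertex.

Definition web_src (n : nat) (p : web_piece) : seq bool :=
  match p with
  | Cross _ => [:: false; false]
  | Cap b => [:: b; ~~ b]
  | BlackVertex => nseq n false
  | Cup _ | WhiteVertex => [::]
  end.

Definition web_tgt (n : nat) (p : web_piece) : seq bool :=
  match p with
  | Cross _ => [:: false; false]
  | Cup b => [:: ~~ b; b]
  | WhiteVertex => nseq n false
  | Cap _ | BlackVertex => [::]
  end.

Definition web_strip := strip bool web_piece.

(* Throughout, [t] is the chosen n-th root q^{1/n}.  The basis vector x_i,    *)
(* 1 <= i <= n, corresponds to the ordinal of value i - 1.                    *)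

Definition admissible (F : fieldType) (n : nat) (q : F) : Prop :=
  q != 0 /\
  (q = 1 \/ q = -1 \/ forall m : nat, (2 <= m <= n)%N -> q ^+ (2 * m) != 1).

Definition qint (F : fieldType) (q : F) (k : nat) : F :=
  \sum_(1 <= i < k.+1) q ^ (- k%:Z - 1 + 2 * i%:Z).

Definition qfact (F : fieldType) (q : F) (k : nat) : F :=
  \prod_(1 <= j < k.+1) qint q j.

(* The coefficient of x_k (x) x_l in R (x_i (x) x_j). *)
Definition Rcoef (F : fieldType) (n : nat) (q t : F) (i j k l : 'I_n) : F :=
  let swap := ((k == j) && (l == i))%:R in
  let keep := ((k == i) && (l == j))%:R in
  t^-1 * (if (j < i)%N then swap
          else if i == j then q * keep
          else swap + (q - q^-1) * keep).

(* The coefficients of R^{-1}; see [RinvK] and [RcoefK] below. *)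
Definition Rinvcoef (F : fieldType) (n : nat) (q t : F) (i j k l : 'I_n) : F :=
  let swap := ((k == j) && (l == i))%:R in
  let keep := ((k == i) && (l == j))%:R in
  t * (if (i < j)%N then swap
       else if i == j then q^-1 * keep
       else swap - (q - q^-1) * keep).

Definition inversions (n : nat) (s : 'S_n) : nat :=
  #|[set p : 'I_n * 'I_n | (p.1 < p.2)%N && (s p.2 < s p.1)%N]|.

(* (-q)^{l(s)} if the word [w] is s(1) ... s(n) for a permutation s, and 0    *)
(* if [w] is not a permutation word.  These are both the values of T_- on     *)
(* the basis vectors and the coordinates of T_+(1).                           *)
Definition Tcoef (F : fieldType) (n : nat) (q : F) (w : seq 'I_n) : F :=
  \sum_(s : 'S_n) (- q) ^+ inversions s * (w == [seq s i | i <- enum 'I_n])%:R.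

(* The coefficient of the basis tensor [w] (upper line) in the image of the   *)
(* basis tensor [u] (lower line) under the map of an elementary piece.        *)
Definition piece_coef (F : fieldType) (n : nat) (q t : F) (p : web_piece)
    (u w : seq 'I_n) : F :=
  match p, u, w with
  | Cross true, [:: i; j], [:: k; l] => Rcoef q t i j k l
  | Cross false, [:: i; j], [:: k; l] => Rinvcoef q t i j k l
  | Cup true, [::], [:: i; j] => (i == j)%:R
  | Cup false, [::], [:: i; j] =>
      q ^ (n%:Z + 1 - 2 * (val i).+1%:Z) * (i == j)%:R
  | Cap true, [:: i; j], [::] => (i == j)%:R
  | Cap false, [:: i; j], [::] =>
      q ^ (2 * (val i).+1%:Z - n%:Z - 1) * (i == j)%:R
  | BlackVertex, _, [::] => Tcoef q u
  | WhiteVertex, [::], _ => Tcoef q w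
  | _, _, _ => 0
  end.

(* A tensor over a horizontal line with k strands is given by its coordinates *)
(* v w, where w ranges over the words of length k; its values on words of     *)
(* other lengths are irrelevant.  This is id (x) (map of the piece) (x) id.   *)
Definition strip_map (F : fieldType) (n : nat) (q t : F) (s : web_strip)
    (v : seq 'I_n -> F) : seq 'I_n -> F :=
  fun w =>
    let a := size (lft s) in
    let b := size (web_tgt n (piece s)) in
    let mid := take b (drop a w) in
    \sum_(u : (size (web_src n (piece s))).-tuple 'I_n)
      piece_coef q t (piece s) u mid * v (take a w ++ u ++ drop (a + b) w).

(* The composite C -> C of all the strip maps, evaluated at 1. *)
Definition web_trace (F : fieldType) (n : nat) (q t : F)
    (ds : seq web_strip) : F :=
  foldl (fun v s => strip_map q t s v) (fun w : seq 'I_n => (w == [::])%:R) ds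
    [::].

Record bigraph := Bigraph {
  bvert : finType;
  wvert : finType;
  edge : finType;
  black : edge -> bvert;
  white : edge -> wvert;
  card_bw : #|bvert| = #|wvert|;
  perfect_matching : exists M : {set edge},
    (forall b, #|[set e in M | black e == b]| = 1%N) /\
    (forall w, #|[set e in M | white e == w]| = 1%N) }.

(* An edge, oriented from black to white, is cut by its local extrema into    *)
(* monotone segments; (e, k) is the k-th segment of e, starting with k = 0 at *)
(* the black end.  Edges leave black vertices downward, so that (e, k) is     *)
(* oriented upward iff k is odd.  Since k increases along the orientation,    *)
(* this labelling rules out closed components.                                *)
Definition strand (G : bigraph) : Type := (edge G * nat)%type.

Definition upward (G : bigraph) (s : strand G) : bool := odd s.2.

(* GCross o s t : strand s goes from bottom left to top right, and t from     *)
(*                bottom right to top left; s is above t iff o = true.        *)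
(* GCup b e k, GCap b e k : the extremum joining segment k of e to segment    *)
(*                k.+1, oriented from left to right iff b = true.             *)
(* GBlack v es, GWhite v ss : a vertex with its half-edges from left to       *)
(*                right, i.e. in the linear order given by the cilium.        *)
Inductive graph_piece (G : bigraph) :=
  | GCross of bool & strand G & strand G
  | GCup of bool & edge G & nat
  | GCap of bool & edge G & nat
  | GBlack of bvert G & seq (edge G)
  | GWhite of wvert G & seq (strand G).

Definition extremum (G : bigraph) (b : bool) (e : edge G) (k : nat) :
    seq (strand G) :=
  if b then [:: (e, k); (e, k.+1)] else [:: (e, k.+1); (e, k)].

Definition graph_src (G : bigraph) (p : graph_piece G) : seq (strand G) :=
  match p with
  | GCross _ s t => [:: s; t]
  | GCap b e k => extremum b e k
  | GBlack _ es => [seq (e, 0%N) | e <- es]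
  | GCup _ _ _ | GWhite _ _ => [::]
  end.

Definition graph_tgt (G : bigraph) (p : graph_piece G) : seq (strand G) :=
  match p with
  | GCross _ s t => [:: t; s]
  | GCup b e k => extremum b e k
  | GWhite _ ss => ss
  | GCap _ _ _ | GBlack _ _ => [::]
  end.

Definition graph_piece_ok (G : bigraph) (p : graph_piece G) : bool :=
  match p with
  | GCross _ s t => ~~ upward s && ~~ upward t
  | GCup _ _ k => ~~ odd k
  | GCap _ _ k => odd k
  | GBlack v es => perm_eq es (enum [pred e | black e == v])
  | GWhite v ss => all (fun s => ~~ upward s) ss
                   && perm_eq [seq s.1 | s <- ss] (enum [pred e | white e == v])
  end.

Definition graph_strip (G : bigraph) := strip (strand G) (graph_piece G).

Definition black_of (G : bigraph) (s : graph_strip G) : option (bvert G) :=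
  if piece s is GBlack v _ then Some v else None.
Definition white_of (G : bigraph) (s : graph_strip G) : option (wvert G) :=
  if piece s is GWhite v _ then Some v else None.

(* A ciliated bipartite ribbon graph with underlying graph G, presented by a  *)
(* diagram.                                                                   *)
Record ribbon_graph (G : bigraph) := RibbonGraph {
  strips :> seq (graph_strip G);
  strips_ok : all (fun s => graph_piece_ok (piece s)) strips;
  strips_stacked : stacked (@graph_src G) (@graph_tgt G) [::] strips [::];
  blacks_once : perm_eq (pmap (@black_of G) strips) (enum (bvert G));
  whites_once : perm_eq (pmap (@white_of G) strips) (enum (wvert G)) }.

Definition multiweb (n : nat) (G : bigraph) (m : edge G -> 'I_n.+1) : Prop :=
  (forall b : bvert G, (\sum_(e | black e == b) m e)%N = n) /\
  (forall w : wvert G, (\sum_(e | white e == w) m e)%N = n).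

Definition split_line (G : bigraph) (m : edge G -> nat) (ss : seq (strand G)) :
    seq bool :=
  flatten [seq nseq (m s.1) (upward s) | s <- ss].

(* A bundle of a strands crosses a bundle of b strands: the strands of the    *)
(* right bundle, starting from the leftmost one, are moved one by one to the  *)
(* left across the whole left bundle.                                         *)
Definition split_cross (over : bool) (a b : nat) : seq web_strip :=
  [seq Strip (nseq i false) (Cross over) (nseq (a + b - i - 2) false)
     | j <- iota 0 b, i <- rev (iota j a)].

Definition split_cup (b : bool) (a : nat) : seq web_strip :=
  [seq Strip (nseq i (~~ b)) (Cup b) (nseq i b) | i <- iota 0 a].
Definition split_cap (b : bool) (a : nat) : seq web_strip :=
  [seq Strip (nseq i b) (Cap b) (nseq i (~~ b)) | i <- rev (iota 0 a)].

Definition split_piece (G : bigraph) (m : edge G -> nat) (p : graph_piece G) :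
    seq web_strip :=
  match p with
  | GCross o s t => split_cross o (m s.1) (m t.1)
  | GCup b e _ => split_cup b (m e)
  | GCap b e _ => split_cap b (m e)
  | GBlack _ _ => [:: Strip [::] BlackVertex [::]]
  | GWhite _ _ => [:: Strip [::] WhiteVertex [::]]
  end.

Definition split_strip (G : bigraph) (m : edge G -> nat) (s : graph_strip G) :
    seq web_strip :=
  [seq Strip (split_line m (lft s) ++ lft x) (piece x)
             (rgt x ++ split_line m (rgt s)) | x <- split_piece m (piece s)].

(* A diagram of W_m: every strand of e is replaced, in the plane of the       *)
(* diagram, by m e parallel strands.                                          *)
Definition split_web (G : bigraph) (D : ribbon_graph G) (m : edge G -> nat) :
    seq web_strip :=
  flatten [seq split_strip m s | s <- strips D].

Definition quantum_trace (F : fieldType) (n : nat) (q t : F) (G : bigraph)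
    (D : ribbon_graph G) (m : edge G -> 'I_n.+1) : F :=
  web_trace n q t (split_web D m) / \prod_(e : edge G) qfact q (m e).

Lemma sum_two_deltas (F : fieldType) (n : nat) (A B : F) (i j : 'I_n)
    (f : 'I_n -> 'I_n -> F) :
  \sum_k \sum_l (A * ((k == j) && (l == i))%:R
                 + B * ((k == i) && (l == j))%:R) * f k l
    = A * f j i + B * f i j.
Proof.
have delta a b : \sum_k \sum_l ((k == a) && (l == b))%:R * f k l = f a b.
  rewrite (bigD1 a) //= [X in _ + X]big1 ?addr0 => [|k /negPf ka]; last first.
    by apply: big1 => l _; rewrite ka mul0r.
  rewrite (bigD1 b) //= big1 ?addr0 ?eqxx ?mul1r // => l /negPf lb.
  by rewrite lb andbF mul0r.
rewrite -(delta j i) -(delta i j) !mulr_sumr -big_split; apply: eq_bigr => k _.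
by rewrite !mulr_sumr -big_split; apply: eq_bigr => l _; rewrite mulrDl !mulrA.
Qed.

Lemma RcoefE (F : fieldType) (n : nat) (q t : F) (i j k l : 'I_n) :
  Rcoef q t i j k l =
    (t^-1 * (i != j)%:R) * ((k == j) && (l == i))%:R +
    (t^-1 * (if (j < i)%N then 0 else if i == j then q else q - q^-1))
      * ((k == i) && (l == j))%:R.
Proof.
rewrite /Rcoef; case: (ltngtP i j) => [ij|ji|/val_inj ->].
- have /negPf-> : i != j by rewrite neq_ltn ij.
  by rewrite /=; ring.
- have -> : i != j by rewrite neq_ltn ji orbT.
  by rewrite /=; ring.
- by rewrite eqxx /=; ring.
Qed.

Lemma RinvcoefE (F : fieldType) (n : nat) (q t : F) (i j k l : 'I_n) :
  Rinvcoef q t i j k l =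
    (t * (i != j)%:R) * ((k == j) && (l == i))%:R +
    (t * (if (i < j)%N then 0 else if i == j then q^-1 else - (q - q^-1)))
      * ((k == i) && (l == j))%:R.
Proof.
rewrite /Rinvcoef; case: (ltngtP i j) => [ij|ji|/val_inj ->].
- have -> : i != j by rewrite neq_ltn ij.
  by rewrite /=; ring.
- have /negPf-> : i != j by rewrite neq_ltn ji orbT.
  by rewrite /=; ring.
- by rewrite eqxx /=; ring.
Qed.

(* [Rinvcoef] is the two-sided inverse of [Rcoef]. *)
Lemma RcoefK (F : fieldType) (n : nat) (q t : F) (i j x y : 'I_n) :
  q != 0 -> t != 0 ->
  \sum_k \sum_l Rcoef q t i j k l * Rinvcoef q t k l x y
    = ((x == i) && (y == j))%:R.
Proof.
move=> q0 t0; under eq_bigr do under eq_bigr do rewrite RcoefE.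
rewrite sum_two_deltas /Rinvcoef; case: (ltngtP i j) => [ij|ji|/val_inj ->].
- have /negPf-> : i != j by rewrite neq_ltn ij.
  have /negPf-> : j != i by rewrite neq_ltn ij orbT.
  by rewrite /=; field; rewrite ?q0 ?t0.
- have /negPf-> : i != j by rewrite neq_ltn ji orbT.
  by rewrite /=; field; rewrite ?q0 ?t0.
- by rewrite eqxx /=; field; rewrite ?q0 ?t0.
Qed.

Lemma RinvK (F : fieldType) (n : nat) (q t : F) (i j x y : 'I_n) :
  q != 0 -> t != 0 ->
  \sum_k \sum_l Rinvcoef q t i j k l * Rcoef q t k l x y
    = ((x == i) && (y == j))%:R.
Proof.
move=> q0 t0; under eq_bigr do under eq_bigr do rewrite RinvcoefE.
rewrite sum_two_deltas /Rcoef; case: (ltngtP i j) => [ij|ji|/val_inj ->].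
- have /negPf-> : i != j by rewrite neq_ltn ij.
  by rewrite /=; field; rewrite ?q0 ?t0.
- have /negPf-> : i != j by rewrite neq_ltn ji orbT.
  have /negPf-> : j != i by rewrite neq_ltn ji.
  by rewrite /=; field; rewrite ?q0 ?t0.
- by rewrite eqxx /=; field; rewrite ?q0 ?t0.
Qed.

Lemma stacked_cat (S P : Type) (src tgt : P -> seq S) a d1 b d2 c :
  stacked src tgt a d1 b -> stacked src tgt b d2 c ->
  stacked src tgt a (d1 ++ d2) c.
Proof. by elim: d1 a => [|s d1 IH] a /= => [-> //|[-> /IH h] /h]. Qed.

Lemma stacked_frame (S P : Type) (src tgt : P -> seq S) l r a d b :
  stacked src tgt a d b ->
  stacked src tgt (l ++ a ++ r)
    [seq Strip (l ++ lft x) (piece x) (rgt x ++ r) | x <- d] (l ++ b ++ r).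
Proof.
elim: d a => [|s d IH] a /= => [-> //|[<- /IH]].
by rewrite /lower /upper /= -!catA.
Qed.

Lemma split_line_cat (G : bigraph) (m : edge G -> nat) s1 s2 :
  split_line m (s1 ++ s2) = split_line m s1 ++ split_line m s2.
Proof. by rewrite /split_line map_cat flatten_cat. Qed.

Lemma stacked_split_cross (n : nat) (o : bool) (a b : nat) :
  stacked (web_src n) (web_tgt n) (nseq a false ++ nseq b false)
    (split_cross o a b) (nseq b false ++ nseq a false).
Proof.
rewrite -!nseqD [(b + a)%N]addnC /split_cross.
have step s : all (fun i => i.+2 <= a + b)%N s ->
  stacked (web_src n) (web_tgt n) (nseq (a + b) false) [seq
    Strip (nseq i false) (Cross o) (nseq (a + b - i - 2) false) | i <- s]
   (nseq (a + b) false).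
  elim: s => //= i s IH /andP[hi /IH hs]; rewrite /lower /upper /=.
  rewrite -[[:: false, false & _]]/(nseq (a + b - i - 2).+2 false) -nseqD.
  by have -> : (i + (a + b - i - 2).+2 = a + b)%N by lia.
have : all (fun j => j < b)%N (iota 0 b).
  by apply/allP => j; rewrite mem_iota.
elim: (iota 0 b) => //= j js IH /andP[jb /IH]; apply: stacked_cat; apply: step.
by apply/allP => i; rewrite mem_rev mem_iota; lia.
Qed.

Lemma stacked_split_cup (n : nat) (b : bool) (a : nat) :
  stacked (web_src n) (web_tgt n) [::] (split_cup b a)
    (nseq a (~~ b) ++ nseq a b).
Proof.
rewrite /split_cup; elim: a => // a IH.
rewrite -{1}addn1 iotaD map_cat; apply: stacked_cat IH _.
rewrite /= /lower /upper /=; split=> //.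
rewrite -[~~ b :: b :: _]/(nseq 1 (~~ b) ++ nseq a.+1 b) catA -nseqD.
by rewrite addn1.
Qed.

Lemma stacked_split_cap (n : nat) (b : bool) (a : nat) :
  stacked (web_src n) (web_tgt n) (nseq a b ++ nseq a (~~ b))
    (split_cap b a) [::].
Proof.
rewrite /split_cap; elim: a => // a IH.
rewrite -{3}addn1 iotaD rev_cat map_cat.
apply: stacked_cat IH; rewrite /= /lower /upper /=; split=> //.
rewrite -[b :: ~~ b :: _]/(nseq 1 b ++ nseq a.+1 (~~ b)) catA -nseqD.
by rewrite addn1.
Qed.

Lemma split_line_down (G : bigraph) (m : edge G -> nat) (ss : seq (strand G)) :
  all (fun s => ~~ upward s) ss ->
  split_line m ss = nseq (\sum_(e <- [seq s.1 | s <- ss]) m e) false.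
Proof.
rewrite /split_line; elim: ss => [|s ss IH] /=; first by rewrite big_nil.
by case/andP=> /negPf-> /IH->; rewrite big_cons nseqD.
Qed.

Lemma stacked_split_piece (n : nat) (G : bigraph) (m : edge G -> 'I_n.+1)
    (p : graph_piece G) :
  multiweb m -> graph_piece_ok p ->
  stacked (web_src n) (web_tgt n) (split_line m (graph_src p))
    (split_piece m p) (split_line m (graph_tgt p)).
Proof.
move=> [mB mW]; case: p => [o s t|b e k|b e k|v es|v ss] /=.
- case/andP=> us ut; have := stacked_split_cross n o (m s.1) (m t.1).
  by rewrite /split_line /= (negPf us) (negPf ut) !cats0.
- move=> /negPf ok; have := stacked_split_cup n b (m e).
  by rewrite /extremum /split_line /upward; case: b => /=; rewrite ok !cats0.
- move=> ok; have := stacked_split_cap n b (m e).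
  by rewrite /extremum /split_line /upward; case: b => /=; rewrite ok !cats0.
- move=> pes; rewrite split_line_down ?all_map; last by apply/allP.
  rewrite -map_comp map_id_in // (perm_big _ pes) big_enum /= mB.
  by rewrite /lower /= cats0.
- case/andP=> ud pes; rewrite [split_line _ ss]split_line_down //.
  by rewrite (perm_big _ pes) big_enum /= mW /upper /= cats0.
Qed.

(* The split web is indeed a diagram closed at the bottom and at the top, so  *)
(* that its trace is a composite of composable strip maps.                    *)
Lemma split_web_stacked (n : nat) (G : bigraph) (D : ribbon_graph G)
    (m : edge G -> 'I_n.+1) :
  multiweb m ->
  stacked (web_src n) (web_tgt n) [::] (split_web D m) [::].
Proof.
move=> hm; rewrite /split_web; case: D => /= ds ok + _ _.
suff main a : stacked (@graph_src G) (@graph_tgt G) a ds [::] ->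
  stacked (web_src n) (web_tgt n) (split_line m a)
    (flatten [seq split_strip m s | s <- ds]) [::] by apply: main.
elim: ds a ok => [|s ds IH] a /=; first by move=> _ ->.
case/andP=> oks /IH {}IH [<- /IH]; apply: stacked_cat.
rewrite /lower /upper !split_line_cat.
exact: stacked_frame (stacked_split_piece hm oks).
Qed.

(* Main.v *)
Require Import Defs.
From mathcomp Require Import all_boot all_order all_algebra.
From mathcomp Require Import fingroup perm.
From mathcomp Require Import ring zify.
From mathcomp Require Import boolp reals complex.

(* Let H = t^-1 R^-1 act on two parallel strands of an edge.  By the           *)
(* Yang-Baxter equation, H slides along the edge through crossings, and, being *)
(* transposed, through cups and caps, from the white end to the black end,     *)
(* where T_- absorbs it with the factor -q.  Since H x_i (x) x_j = x_j (x) x_i *)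
(* for i < j, exchanging two letters i < j inside a block of T_+ (the slots of *)
(* one edge) multiplies the trace by -q, and the coefficient of T_+ by -q as   *)
(* well.  So the m_e! words with a given set of letters in the block of e      *)
(* contribute sum_w q^(2 l(w)) = q^(m_e (m_e - 1) / 2) [m_e]! times the        *)
(* increasing one.  Keeping only the words of T_+ that increase in each block  *)
(* thus divides the trace by prod_e q^(...) [m_e]!, and the remaining state    *)
(* sum is visibly a Laurent polynomial in t.                                   *)

Set Implicit Arguments.
Unset Strict Implicit.
Unset Printing Implicit Defensive.

Import Order.TTheory GRing.Theory Num.Theory.
Local Open Scope ring_scope.
Local Open Scope complex_scope.

(** * Operators acting on consecutive letters *)

(** The state sum of [split_web D m] is a Laurent polynomial in [t] for obvious reasons; the content
    is that it is divisible by the product of all [m_e]!, with a quotient given by one formula valid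
    for every admissible [q].

    The factor of an edge comes from a symmetry among its parallel copies. Inserting the Hecke-type
    operator H = [hecke] on two adjacent copies, anywhere along the edge, multiplies the whole trace
    by -q ([hecke_slide]). This combines the Yang-Baxter relation at crossings
    ([bundle_cross_slide_left], [bundle_cross_slide_right]), the symmetry of nested extrema
    ([bundle_cup_slide], [bundle_cap_slide]), and the fact that T_- is an eigenvector of the
    transpose of H ([black_absorb]).

    At the white end, the trace is a linear functional of the tensor placed there. For x < y, H maps
    a basis word containing x y to the word with y x ([hecke_delta]), so each inversion created
    inside a block costs -q in the functional, and another -q in the coefficient of T_+. The sum
    over the orderings of a block is then the generating function of inversions at q^2
    ([sum_blocks], [value_reduce]), which is a power of [q] times [m_e]! ([block_factE]). Since
    every edge has exactly one white end, treating all white vertices ([reduce_vertices]) extracts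
    the whole denominator. What remains is a state sum with Laurent coefficients
    ([laurent_graph_run]). *)

Section LocalOperators.
Context (F : fieldType) (n : nat).
Implicit Types (v f g : seq 'I_n -> F) (w : seq 'I_n).
Notation tensor := (seq 'I_n -> F).

(* Words shorter than [a] are left alone, which makes [at_pos a id] the       *)
(* identity.                                                                  *)
Fixpoint at_pos (a : nat) (T : tensor -> tensor) v w : F :=
  match a, w with
  | 0, _ => T v w
  | a'.+1, x :: w' => at_pos a' T (fun u => v (x :: u)) w'
  | _.+1, [::] => v [::]
  end.

Definition lin (T : tensor -> tensor) : Prop :=
  forall c d f g w, T (fun u => c * f u + d * g u) w = c * T f w + d * T g w.

(* [T] acts on the first [K] letters, producing the first [L] ones. *)
Definition local (K L : nat) (T : tensor -> tensor) : Prop :=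
  forall f g w z, size w = L -> (forall u, size u = K -> f (u ++ z) = g u) ->
    T f (w ++ z) = T g w.

(** Operators take default values on words too short for them, so many identities below are only
    claimed for words that reach all the letters acted upon. *)
Definition eq_from (N : nat) f g : Prop :=
  forall w, (N <= size w)%N -> f w = g w.

Lemma at_pos_comp a (T1 T2 : tensor -> tensor) v :
  at_pos a (fun f => T2 (T1 f)) v = at_pos a T2 (at_pos a T1 v).
Proof.
apply/funext => w; elim: a v w => // a IH v [|x w] //=; exact: IH.
Qed.

Lemma at_pos_add a b (T : tensor -> tensor) v :
  at_pos (a + b) T v = at_pos a (at_pos b T) v.
Proof. by apply/funext => w; elim: a v w => // a IH v [|x w] //=. Qed.

Lemma at_pos_id a v : at_pos a id v = v.
Proof. by apply/funext => w; elim: a v w => [|a IH] v [|x w] //=;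
  rewrite IH. Qed.

Lemma at_pos_cat (T : tensor -> tensor) b v u w :
  at_pos (size u + b) T v (u ++ w) = at_pos b T (fun z => v (u ++ z)) w.
Proof. by elim: u v => //= x u IH v; rewrite IH. Qed.

Lemma lin_at_pos a (T : tensor -> tensor) : lin T -> lin (at_pos a T).
Proof.
move=> hT c d f g w; elim: a f g w => [|a IH] f g w; first exact: hT.
by case: w => [|x w] //=; exact: IH.
Qed.

Lemma lin_comp (T1 T2 : tensor -> tensor) :
  lin T1 -> lin T2 -> lin (fun v => T2 (T1 v)).
Proof.
move=> h1 h2 c d f g w; rewrite -h2; congr (T2 _ w).
by apply/funext => u; rewrite h1.
Qed.

Lemma lin0 (T : tensor -> tensor) w : lin T -> T (fun _ => 0) w = 0.
Proof.
move=> hT; have := hT 0 0 (fun _ => 0) (fun _ => 0) w.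
by rewrite !mul0r !addr0.
Qed.

Lemma linZ (T : tensor -> tensor) c f w : lin T ->
  T (fun u => c * f u) w = c * T f w.
Proof.
move=> hT; have := hT c 0 f f w.
rewrite mul0r addr0 => <-; congr (T _ w).
by apply/funext => u; rewrite ?mul0r ?addr0.
Qed.

Lemma lin_sum (T : tensor -> tensor) (I : Type) (r : seq I) (P : pred I)
    (f : I -> tensor) w :
  lin T -> T (fun u => \sum_(i <- r | P i) f i u) w =
    \sum_(i <- r | P i) T (f i) w.
Proof.
move=> hT; elim: r => [|i r IH].
  rewrite big_nil -[RHS](lin0 w hT); congr (T _ w).
  by apply/funext => u; rewrite big_nil.
rewrite big_cons -IH; case: ifP => Pi; last first.
  by congr (T _ w); apply/funext => u; rewrite big_cons Pi.
rewrite -[T (f i) w]mul1r -[X in _ + X]mul1r -hT; congr (T _ w).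
by apply/funext => u; rewrite big_cons Pi !mul1r.
Qed.

Lemma local_at_pos a K L (T : tensor -> tensor) :
  local K L T -> local (a + K) (a + L) (at_pos a T).
Proof.
move=> hT; elim: a => [|a IH] f g w z; first exact: hT.
case: w => [|x w] //=.
move=> [sw] fg; apply: IH => // u su; apply: (fg (x :: u)).
by rewrite /= su.
Qed.

Lemma local_slice K L (T : tensor -> tensor) v w z : local K L T -> size w =
  L ->
  T v (w ++ z) = T (fun u => v (u ++ z)) w.
Proof. by move=> hT sw; apply: hT. Qed.

Lemma local_widen b K L (T : tensor -> tensor) :
  local K L T -> local (K + b) (L + b) T.
Proof.
move=> hT f g w z sw fg; rewrite -(cat_take_drop L w) -catA.
have s1 : size (take L w) = L by rewrite size_takel // sw leq_addr.
have s2 : size (drop L w) = b by rewrite size_drop sw addKn.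
rewrite [RHS](local_slice _ _ hT s1); apply: hT => // u su.
by rewrite catA fg // size_cat su s2.
Qed.

Lemma local_comp K L M (T1 T2 : tensor -> tensor) :
  local K L T1 -> local L M T2 -> local K M (fun v => T2 (T1 v)).
Proof. by move=> h1 h2 f g w z sw fg; apply: h2 => // u su; apply: h1. Qed.

Lemma local_eq K L (T : tensor -> tensor) f g :
  local K L T -> eq_from K f g -> eq_from L (T f) (T g).
Proof.
move=> hT fg w sw; rewrite -(cat_take_drop L w).
have s1 : size (take L w) = L by rewrite size_takel.
rewrite [RHS](local_slice _ _ hT s1); apply: hT => // u su.
by rewrite fg // size_cat su leq_addr.
Qed.

Lemma eq_from_trans N f g h : eq_from N f g -> eq_from N g h -> eq_from N f h.
Proof. by move=> fg gh w sw; rewrite fg // gh. Qed.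

Lemma eq_from_sym N f g : eq_from N f g -> eq_from N g f.
Proof. by move=> fg w sw; rewrite fg. Qed.

Lemma eq_from_le N N' f g : (N <= N')%N -> eq_from N f g -> eq_from N' f g.
Proof. by move=> le fg w sw; apply: fg; apply: leq_trans sw. Qed.

Lemma eq_from_at_pos a N (T1 T2 : tensor -> tensor) v :
  (forall f, eq_from N (T1 f) (T2 f)) ->
  eq_from (a + N) (at_pos a T1 v) (at_pos a T2 v).
Proof.
move=> h; elim: a v => [|a IH] v; first exact: h.
by case=> [|x w] // sw; apply: IH.
Qed.

(* The common form of R, R^-1 and the operators [hecke] below. *)
Definition two_letter (s e dlt dgt : F) v w : F :=
  if w is x :: y :: w' then
    s * (if x == y then e * v w
         else v (y :: x :: w') + (if (x < y)%N then dlt else dgt) * v w)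
  else 0.

Lemma lin_two_letter s e d1 d2 : lin (two_letter s e d1 d2).
Proof. by move=> c d f g [|x [|y w]] /=; [ring|ring|case: ifP => _; ring]. Qed.

Lemma local_two_letter s e d1 d2 : local 2 2 (two_letter s e d1 d2).
Proof. by move=> f g [|x [|y []]] z //= _ fg; rewrite -!fg. Qed.

(** The two-letter operator acts on the parameter [z] of a family of tensors: it forms linear
    combinations of members of the family, with scalars independent of [w], and a linear [T]
    respects these. *)
Lemma two_letter_exchange s e d1 d2 b (T : tensor -> tensor)
    (f : seq 'I_n -> tensor) w z :
  lin T ->
  at_pos b (two_letter s e d1 d2) (fun u => T (f u) w) z =
  T (fun x => at_pos b (two_letter s e d1 d2) (fun u => f u x) z) w.
Proof.
move=> hT; elim: b f z => [|b IH] f z; last first.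
  by case: z => [|x z] //=; exact: IH.
case: z => [|x [|y z]] /=; rewrite ?lin0 //.
case: ifP => xy.
  by rewrite mulrA -linZ //; congr (T _ w); apply/funext => u; rewrite mulrA.
rewrite mulrDr mulrA -hT; congr (T _ w).
by apply/funext => u; rewrite mulrDr mulrA.
Qed.

(** Operators on disjoint letters commute. With [T] on the right no position shifts, and the
    identity is exact even on short words. *)
Lemma two_letter_commL s e d1 d2 a b (T : tensor -> tensor) v :
  lin T -> (b + 2 <= a)%N ->
  at_pos a T (at_pos b (two_letter s e d1 d2) v) =
  at_pos b (two_letter s e d1 d2) (at_pos a T v).
Proof.
move=> hT le; apply/funext => w.
elim: b a le v w => [|b IH] [|a] // le v w; last first.
  by case: w => [|x w] //=; rewrite IH.
case: a le => // a _; case: w => [|x [|y w]] //=.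
exact/esym/(two_letter_exchange s e d1 d2 0 (fun u x => v (u ++ x))
  w [:: x; y] (lin_at_pos a hT)).
Qed.

(** With [T] on the left, the two letters shift because [T] replaces [K] letters by [L]; words of
    length at least [L] are those where the locality of [T] applies. *)
Lemma two_letter_commR s e d1 d2 K L b (T : tensor -> tensor) v :
  lin T -> local K L T ->
  eq_from L (T (at_pos (K + b) (two_letter s e d1 d2) v))
    (at_pos (L + b) (two_letter s e d1 d2) (T v)).
Proof.
move=> hT lT w sw; rewrite -(cat_take_drop L w).
have s1 : size (take L w) = L by rewrite size_takel.
rewrite -{3}s1 at_pos_cat.
rewrite (_ : (fun z => _) = fun z => T (fun u => v (u ++ z)) (take L w)).
  rewrite (two_letter_exchange s e d1 d2 b (fun z u => v (u ++ z)) _ _ hT).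
  by apply: lT => // u <-; rewrite at_pos_cat.
by apply/funext => z; apply: lT.
Qed.

End LocalOperators.

Arguments at_pos : simpl never.

Arguments lin_at_pos {F n} a {T}.
Arguments local_at_pos {F n} a {K L T}.
Arguments local_widen {F n} b {K L T}.

(** * Sliding through a crossing of bundles *)

Section Slides.
Context (F : fieldType) (n : nat) (q t : F).
Implicit Types (v f g : seq 'I_n -> F) (w : seq 'I_n).
Notation tensor := (seq 'I_n -> F).

Definition cross_op (o : bool) : tensor -> tensor :=
  if o then two_letter t^-1 q (q - q^-1) 0
  else two_letter t q^-1 0 (- (q - q^-1)).

(* [t^-1 R^-1] on two downward strands, and its transpose rotated by a half   *)
(* turn on two upward strands.                                                *)
Definition hecke (up : bool) : tensor -> tensor :=
  if up then two_letter 1 q^-1 (- (q - q^-1)) 0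
  else two_letter 1 q^-1 0 (- (q - q^-1)).

Lemma lin_cross o : lin (cross_op o).
Proof. by case: o; apply: lin_two_letter. Qed.

Lemma local_cross o : local 2 2 (cross_op o).
Proof. by case: o; apply: local_two_letter. Qed.

Lemma lin_hecke up : lin (hecke up).
Proof. by case: up; apply: lin_two_letter. Qed.

Lemma local_hecke up : local 2 2 (hecke up).
Proof. by case: up; apply: local_two_letter. Qed.

Lemma cross_commR o K L b (T : tensor -> tensor) v : lin T -> local K L T ->
  eq_from L (T (at_pos (K + b) (cross_op o) v)) (at_pos (L + b) (cross_op o)
    (T v)).
Proof. by case: o; apply: two_letter_commR. Qed.

Lemma hecke_commL up a b (T : tensor -> tensor) v : lin T -> (b + 2 <= a)%N ->
  at_pos a T (at_pos b (hecke up) v) = at_pos b (hecke up) (at_pos a T v).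
Proof. by case: up; apply: two_letter_commL. Qed.

Lemma hecke_commR up K L b (T : tensor -> tensor) v : lin T -> local K L T ->
  eq_from L (T (at_pos (K + b) (hecke up) v)) (at_pos (L + b) (hecke up) (T v)).
Proof. by case: up; apply: two_letter_commR. Qed.

(* The last of [a.+1] strands moves to the left across the other ones. *)
Fixpoint column (o : bool) (a : nat) v : tensor :=
  if a is a'.+1 then column o a' (at_pos a' (cross_op o) v) else v.

Fixpoint bundle_cross (o : bool) (a b : nat) v : tensor :=
  if b is b'.+1 then at_pos b' (column o a) (bundle_cross o a b' v) else v.

Lemma lin_column o a : lin (column o a).
Proof.
elim: a => [|a IH]; first by move=> c d f g w.
exact: lin_comp (lin_at_pos a (lin_cross o)) IH.
Qed.

Lemma local_column o a : local a.+1 a.+1 (column o a).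
Proof.
elim: a => [|a IH]; first by move=> f g w z sw fg; exact: fg.
have := local_at_pos a (local_cross o); rewrite addn2 => h.
have {}IH := local_widen 1 IH; rewrite addn1 in IH.
exact: local_comp h IH.
Qed.

Arguments local_column : clear implicits.

Lemma lin_bundle_cross o a b : lin (bundle_cross o a b).
Proof.
elim: b => [|b IH]; first by move=> c d f g w.
exact: lin_comp IH (lin_at_pos b (lin_column o a)).
Qed.

Lemma local_bundle_cross o a b : local (a + b) (a + b) (bundle_cross o a b).
Proof.
elim: b => [|b IH]; first by move=> f g w z sw fg; exact: fg.
have h := local_at_pos b (local_column o a).
have -> : (a + b.+1 = b + a.+1)%N by lia.
apply: local_comp h; have := local_widen 1 IH.
by have -> : (a + b + 1 = b + a.+1)%N by lia.
Qed.

Arguments local_bundle_cross : clear implicits.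

Lemma column_add o a b v :
  column o (a + b) v = column o a (at_pos a (column o b) v).
Proof.
elim: b v => [|b IH] v; first by rewrite addn0 [at_pos _ _ _]at_pos_id.
by rewrite addnS /= IH at_pos_add -at_pos_comp.
Qed.

Lemma bundle_cross_add o a b c v :
  bundle_cross o a (b + c) v =
    at_pos b (bundle_cross o a c) (bundle_cross o a b v).
Proof.
elim: c => [|c IH]; first by rewrite addn0 [at_pos _ _ _]at_pos_id.
by rewrite addnS /= IH at_pos_add -at_pos_comp.
Qed.

Context (q0 : q != 0) (t0 : t != 0).

(** The Yang-Baxter relation, H being a multiple of R^-1: a third strand moves left across the two
    strands that carry H. *)
Lemma yang_baxter_left o v :
  cross_op o (at_pos 1 (cross_op o) (hecke false v)) =
  at_pos 1 (hecke false) (cross_op o (at_pos 1 (cross_op o) v)).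
Proof.
apply/funext => w; rewrite /cross_op /hecke /at_pos.
case: o; case: w => [|x [|y [|z w]]] //=;
  rewrite ?mulr0 ?addr0 ?if_same ?mulr0 // -!val_eqE /=;
  (* All coefficients depend only on the relative order of the three letters; [lia] discards the
     inconsistent orders. *)
  case: (ltngtP x y) => [?|?|/val_inj ?];
    case: (ltngtP y z) => [?|?|/val_inj ?];
  case: (ltngtP x z) => [?|?|/val_inj ?]; try (exfalso; lia);
  try subst; try (exfalso; lia); rewrite ?ltnn ?eqxx; by field; rewrite ?q0 ?t0.
Qed.

(** The mirror situation: a strand moves right across the two strands that carry H. *)
Lemma yang_baxter_right o v :
  at_pos 1 (cross_op o) (cross_op o (at_pos 1 (hecke false) v)) =
  hecke false (at_pos 1 (cross_op o) (cross_op o v)).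
Proof.
apply/funext => w; rewrite /cross_op /hecke /at_pos.
case: o; case: w => [|x [|y [|z w]]] //=;
  rewrite ?mulr0 ?addr0 ?if_same ?mulr0 // -!val_eqE /=;
  case: (ltngtP x y) => [?|?|/val_inj ?];
    case: (ltngtP y z) => [?|?|/val_inj ?];
  case: (ltngtP x z) => [?|?|/val_inj ?]; try (exfalso; lia);
  try subst; try (exfalso; lia); rewrite ?ltnn ?eqxx; by field; rewrite ?q0 ?t0.
Qed.

(** The moving strand first crosses the strands to the right of H, then the two strands carrying H,
    then those to the left. The outer stages commute with H and the middle one is
    [yang_baxter_left]. The strand ends up on the far left, hence the shift by one. *)
Lemma column_slide o a r v : (r + 2 <= a)%N ->
  eq_from a.+1 (column o a (at_pos r (hecke false) v))
    (at_pos r.+1 (hecke false) (column o a v)).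
Proof.
move=> /subnKC <-; move: (a - _)%N => {a} k.
rewrite !(column_add o (r + 2)) hecke_commL //; last exact: lin_column.
move: (at_pos (r + 2) _ v) => {}v.
have col2 f : column o (r + 2) f =
    column o r (at_pos r (fun g => cross_op o (at_pos 1 (cross_op o) g)) f).
  exact: column_add.
rewrite !col2 -at_pos_comp.
have -> : (fun f => cross_op o (at_pos 1 (cross_op o) (hecke false f))) =
    (fun f => at_pos 1 (hecke false) (cross_op o (at_pos 1 (cross_op o) f))).
  by apply/funext => f; rewrite yang_baxter_left.
rewrite (at_pos_comp _ _ (at_pos 1 (hecke false))) -at_pos_add addn1.
have le : (r.+1 <= (r + 2 + k).+1)%N by lia.
apply: (eq_from_le le).
have := hecke_commR false 0 _ (lin_column o r) (local_column o r).
by rewrite !addn0; apply.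
Qed.

(** Induction on the number of strands crossed: both moving strands first cross the last strand of
    the bundle, where [yang_baxter_right] applies. *)
Lemma two_columns_slide o a v :
  eq_from a.+2 (at_pos 1 (column o a) (column o a (at_pos a (hecke false) v)))
    (hecke false (at_pos 1 (column o a) (column o a v))).
Proof.
elim: a v => [|a IH] v.
  by rewrite [at_pos 1 _ _]at_pos_id [at_pos 1 _ _]at_pos_id.
(* The first crossing of the second strand may be performed before the first strand crosses the
   other [a] strands, since the letters involved are disjoint. *)
have step f : eq_from a.+2
    (at_pos 1 (column o a.+1) (column o a.+1 f))
    (at_pos 1 (column o a) (column o a (at_pos a.+1 (cross_op o) (at_pos a
      (cross_op o) f)))).
  rewrite /= at_pos_comp -at_pos_add add1n.
  apply: (local_eq (local_at_pos 1 (local_column o a))).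
  have := cross_commR o 0 (at_pos a (cross_op o) f) (lin_column o a)
    (local_column o a).
  by rewrite !addn0 => h; apply: eq_from_le (eq_from_sym h).
have core : at_pos a.+1 (cross_op o) (at_pos a (cross_op o) (at_pos a.+1
  (hecke false) v))
    = at_pos a (hecke false) (at_pos a.+1 (cross_op o) (at_pos a (cross_op o)
      v)).
  rewrite -addn1 !at_pos_add -!at_pos_comp; congr (at_pos _ _ _).
  by apply/funext => f; rewrite yang_baxter_right.
apply: (eq_from_le (leqnSn a.+2)).
apply: eq_from_trans (step _) _; rewrite core.
apply: eq_from_trans (IH _) _; apply: eq_from_sym.
have h := local_widen a (local_hecke false); rewrite add2n in h.
exact: local_eq h (step v).
Qed.

Lemma bundle_cross_slide_left o a b r v : (r + 2 <= a)%N ->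
  eq_from (a + b) (bundle_cross o a b (at_pos r (hecke false) v))
    (at_pos (b + r) (hecke false) (bundle_cross o a b v)).
Proof.
move=> ra; elim: b => [|b IH] //=.
have h := local_at_pos b (local_column o a).
have le : (a + b <= b + a.+1)%N by lia.
rewrite addnS addnC -addnS;
  apply: eq_from_trans (local_eq h (eq_from_le le IH)) _.
move: (bundle_cross o a b v) {IH h} => {}v.
rewrite [(b.+1 + r)%N](_ : _ = b + r.+1)%N; last by lia.
rewrite !at_pos_add -!at_pos_comp; apply: eq_from_at_pos => f.
exact: column_slide.
Qed.

(** The right bundle is cut into the [r] strands before H, the two carrying it and the [k] after it;
    only the middle pair interacts with H, through [two_columns_slide]. *)
Lemma bundle_cross_slide_right o a b r v : (r + 2 <= b)%N ->
  eq_from (a + b) (bundle_cross o a b (at_pos (a + r) (hecke false) v))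
    (at_pos r (hecke false) (bundle_cross o a b v)).
Proof.
move=> /subnKC <-; move: (b - _)%N => {b} k.
rewrite !(bundle_cross_add o a (r + 2)) -hecke_commL //;
  last exact: lin_bundle_cross.
have h := local_at_pos (r + 2) (local_bundle_cross o a k).
rewrite [(a + _)%N](_ : _ = r + 2 + (a + k))%N; last by lia.
apply: local_eq h _; rewrite !addn2 /=.
have le : (a + r <= r + 2 + (a + k))%N by lia.
have := hecke_commR false 0 v (lin_bundle_cross o a r) (local_bundle_cross o a
  r).
rewrite !addn0 => /(eq_from_le le) {}h.
move: (bundle_cross o a r _) (bundle_cross o a r v) h => f g h.
have two x : at_pos r.+1 (column o a) (at_pos r (column o a) x) =
    at_pos r (fun y => at_pos 1 (column o a) (column o a y)) x.
  by rewrite -addn1 at_pos_add -at_pos_comp.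
have lc : local (a + 2) (a + 2) (fun y => at_pos 1 (column o a) (column o a y)).
  have h1 := local_widen 1 (local_column o a).
  have h2 := local_at_pos 1 (local_column o a).
  by move: h1 h2; rewrite add1n addn1 addn2; apply: local_comp.
have lc' := local_widen k (local_at_pos r lc).
have -> : (r.+2 + (a + k) = r + (a + 2) + k)%N by lia.
rewrite !two; apply: (@eq_from_trans _ _ _ _ (at_pos r (fun y =>
  at_pos 1 (column o a) (column o a y)) (at_pos r (at_pos a (hecke false)) g))).
  rewrite -at_pos_add [(r + a)%N]addnC;
  apply: (local_eq lc').
  by have -> : (r + (a + 2) + k = r + 2 + (a + k))%N by lia.
rewrite -!at_pos_comp.
have le2 : (r + a.+2 <= r + (a + 2) + k)%N by lia.
by apply: (eq_from_le le2); apply: eq_from_at_pos => x;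
  apply: two_columns_slide.
Qed.

End Slides.

Arguments local_bundle_cross {F n}.
Arguments local_column {F n}.
Arguments hecke : simpl never.

(** * Sliding through cups and caps *)

Section Extrema.
Context (F : fieldType) (n : nat) (q : F).
Implicit Types (v f g : seq 'I_n -> F) (w : seq 'I_n).
Notation tensor := (seq 'I_n -> F).

Definition cup_weight (b : bool) (i : 'I_n) : F :=
  if b then 1 else q ^ (n%:Z + 1 - 2 * (val i).+1%:Z).

Definition cap_weight (b : bool) (i : 'I_n) : F :=
  if b then 1 else q ^ (2 * (val i).+1%:Z - n%:Z - 1).

Definition cup_op (b : bool) v w : F :=
  if w is i :: j :: w' then cup_weight b i * (i == j)%:R * v w' else 0.

Definition cap_op (b : bool) v w : F :=
  \sum_i cap_weight b i * v (i :: i :: w).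

Fixpoint bundle_cup (b : bool) (a : nat) v : tensor :=
  if a is a'.+1 then at_pos a' (cup_op b) (bundle_cup b a' v) else v.

Fixpoint bundle_cap (b : bool) (a : nat) v : tensor :=
  if a is a'.+1 then bundle_cap b a' (at_pos a' (cap_op b) v) else v.

Lemma lin_cup b : lin (cup_op b).
Proof. by move=> c d f g [|x [|y w]] /=; ring. Qed.

Lemma local_cup b : local 0 2 (cup_op b).
Proof. by move=> f g [|x [|y []]] z //= _ fg; rewrite -!fg. Qed.

Lemma lin_cap b : lin (cap_op b).
Proof.
move=> c d f g w; rewrite /cap_op !mulr_sumr -big_split /=.
by apply: eq_bigr => i _; ring.
Qed.

Lemma local_cap b : local 2 0 (cap_op b).
Proof. by move=> f g [] // z _ fg; apply: eq_bigr => i _; rewrite -fg. Qed.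

Lemma lin_bundle_cup b a : lin (bundle_cup b a).
Proof.
elim: a => [|a IH]; first by move=> c d f g w.
exact: lin_comp IH (lin_at_pos a (lin_cup b)).
Qed.

Lemma lin_bundle_cap b a : lin (bundle_cap b a).
Proof.
elim: a => [|a IH]; first by move=> c d f g w.
exact: lin_comp (lin_at_pos a (lin_cap b)) IH.
Qed.

Lemma local_bundle_cup b a : local 0 (a + a) (bundle_cup b a).
Proof.
elim: a => [|a IH]; first by move=> f g w z sw fg; exact: fg.
have h := local_widen a (local_at_pos a (local_cup b)).
rewrite addn0 in h; have -> : (a.+1 + a.+1 = a + 2 + a)%N by lia.
exact: local_comp IH h.
Qed.

Lemma local_bundle_cap b a : local (a + a) 0 (bundle_cap b a).
Proof.
elim: a => [|a IH]; first by move=> f g w z sw fg; exact: fg.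
have h := local_widen a (local_at_pos a (local_cap b)).
rewrite addn0 in h; have -> : (a.+1 + a.+1 = a + 2 + a)%N by lia.
exact: local_comp h IH.
Qed.

Arguments local_bundle_cup : clear implicits.
Arguments local_bundle_cap : clear implicits.

Lemma bundle_cup_add b a c v :
  bundle_cup b (a + c) v = at_pos a (bundle_cup b c) (bundle_cup b a v).
Proof.
elim: c => [|c IH]; first by rewrite addn0 [at_pos _ _ _]at_pos_id.
by rewrite addnS /= IH at_pos_add -at_pos_comp.
Qed.

Lemma bundle_cap_add b a c v :
  bundle_cap b (a + c) v = bundle_cap b a (at_pos a (bundle_cap b c) v).
Proof.
elim: c v => [|c IH] v; first by rewrite addn0 [at_pos _ _ _]at_pos_id.
by rewrite addnS /= IH at_pos_add -at_pos_comp.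
Qed.

(** Two nested cups produce only words starting with x y y x, with a weight symmetric in [x] and
    [y]. So acting on the two left legs amounts to acting on the two right ones, which carry the
    letters in reverse order; this reversal negates the flag of [hecke]. *)
Lemma two_cups_slide b s v :
  hecke q s (bundle_cup b 2 v) = at_pos 2 (hecke q (~~ s)) (bundle_cup b 2 v).
Proof.
apply/funext => w; rewrite /hecke /= /at_pos.
case: s; case: w => [|x [|y [|z [|u w]]]] //=;
  try by rewrite !(mulr0, addr0, if_same).
all: have zero (k l : bool) (c d e : F) : ~~ (k && l) ->
    c * k%:R * (d * l%:R * e) = 0
  by case: k l => [] [] // _; rewrite /= ?(mulr0, mul0r).
(* On x y y x only the terms keeping the letters survive, on x y x y only the exchanging ones, and
   on all other words both sides vanish. *)
all: have [/andP[/eqP<- /eqP<-]|yx] := boolP ((y == z) && (x == u));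
  first by rewrite !eqxx -!val_eqE /=; case: (ltngtP x y) => [?|?|/val_inj->];
    rewrite /= ?(mulr0n, mulr1n); ring.
all: rewrite (zero _ _ _ _ _ yx).
all: have [/andP[/eqP<- /eqP<-]|xy] := boolP ((x == z) && (y == u));
  first by rewrite !eqxx; case: ifP => _; rewrite ?mulr0; ring.
all: rewrite (zero _ _ _ _ _ xy) zero 1?andbC //.
all: by rewrite !(mulr0, addr0, if_same).
Qed.

(** Under the sum over [x] and [y], the terms that keep the letters ([g] below) are common to both
    sides, and the exchanging terms match after swapping the names of the summation variables. *)
Lemma two_caps_slide b s v :
  bundle_cap b 2 (hecke q s v) = bundle_cap b 2 (at_pos 2 (hecke q (~~ s)) v).
Proof.
apply/funext => w; rewrite /= /at_pos /= /cap_op.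
under eq_bigr do rewrite mulr_sumr.
under [RHS]eq_bigr do rewrite mulr_sumr.
have lhs x y : hecke q s v [:: x, y, y, x & w] =
   if x == y then q^-1 * v [:: x, y, y, x & w] else v [:: y, x, y, x & w]
    + (if (x < y)%N == s then - (q - q^-1) else 0) * v [:: x, y, y, x & w].
  by rewrite /hecke; case: s => /=; rewrite mul1r; case: (x < y)%N.
have rhs x y : hecke q (~~ s) (fun u => v [:: x, y & u]) [:: y, x & w] =
   if x == y then q^-1 * v [:: x, y, y, x & w] else v [:: x, y, x, y & w]
    + (if (x < y)%N == s then - (q - q^-1) else 0) * v [:: x, y, y, x & w].
  rewrite /hecke; case: s {lhs} => /=; rewrite mul1r -!val_eqE /=;
    by case: (ltngtP x y) => // /val_inj->.
pose g x y := if x == y then q^-1 * v [:: x, y, y, x & w] else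
  (if (x < y)%N == s then - (q - q^-1) else 0) * v [:: x, y, y, x & w].
have lhs' x y : hecke q s v [:: x, y, y, x & w] =
  (x != y)%:R * v [:: y, x, y, x & w] + g x y.
  by rewrite lhs /g; case: eqP; rewrite /= ?mul0r ?mul1r ?add0r.
have rhs' x y : hecke q (~~ s) (fun u => v [:: x, y & u]) [:: y, x & w] =
  (x != y)%:R * v [:: x, y, x, y & w] + g x y.
  by rewrite rhs /g; case: eqP; rewrite /= ?mul0r ?mul1r ?add0r.
under eq_bigr do under eq_bigr do rewrite lhs' !mulrDr.
under [RHS]eq_bigr do under eq_bigr do rewrite rhs' !mulrDr.
under eq_bigr do rewrite big_split.
under [RHS]eq_bigr do rewrite big_split.
rewrite !big_split; congr (_ + _); rewrite exchange_big.
apply: eq_bigr => x _; apply: eq_bigr => y _.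
by rewrite eq_sym; ring.
Qed.

(** Legs are nested, so position i is joined to 2a - 1 - i. The pair starting at [r] thus faces the
    pair starting at 2a - r - 2 = r + 2 + 2k. *)
Lemma bundle_cup_slide b s r k v (a := (r + 2 + k)%N) :
  eq_from (a + a) (at_pos r (hecke q s) (bundle_cup b a v))
    (at_pos (r + 2 + (k + k)) (hecke q (~~ s)) (bundle_cup b a v)).
Proof.
rewrite /a bundle_cup_add -hecke_commL //; last exact: lin_bundle_cup.
rewrite bundle_cup_add -at_pos_comp.
have -> : (fun f => hecke q s (bundle_cup b 2 f)) =
    (fun f => at_pos 2 (hecke q (~~ s)) (bundle_cup b 2 f)).
  by apply/funext => f; rewrite two_cups_slide.
rewrite (at_pos_comp _ _ (at_pos 2 (hecke q (~~ s)))) -at_pos_add.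
move: (at_pos r _ _) => f.
have le : (r + 2 + (k + k) <= r + 2 + k + (r + 2 + k))%N by lia.
apply: (eq_from_le le).
have := hecke_commR q (~~ s) 0 f (lin_at_pos (r + 2) (lin_bundle_cup b k))
  (local_at_pos (r + 2) (local_bundle_cup b k)).
by rewrite !addn0.
Qed.

Lemma bundle_cap_slide b s r k v (a := (r + 2 + k)%N) :
  eq_from 0 (bundle_cap b a (at_pos r (hecke q s) v))
    (bundle_cap b a (at_pos (r + 2 + (k + k)) (hecke q (~~ s)) v)).
Proof.
rewrite /a !(bundle_cap_add _ (r + 2)) hecke_commL //;
  last exact: lin_bundle_cap.
have h := local_bundle_cap b (r + 2).
apply: (@eq_from_trans _ _ _ _ (bundle_cap b (r + 2) (at_pos (r + 2) (hecke q
  (~~ s)) (at_pos (r + 2) (bundle_cap b k) v)))).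
  move: (at_pos (r + 2) (bundle_cap b k) v) => f w _.
  rewrite !(bundle_cap_add _ r 2) at_pos_add -!at_pos_comp.
  congr (bundle_cap b r _ w); congr (at_pos r _ _).
  by apply/funext => g; rewrite two_caps_slide.
apply: eq_from_sym; apply: (local_eq h).
have le : (r + 2 <= r + 2 + (r + 2))%N by lia.
apply: (eq_from_le le).
have := hecke_commR q (~~ s) 0 v (lin_at_pos (r + 2) (lin_bundle_cap b k))
  (local_at_pos (r + 2) (local_bundle_cap b k)).
by rewrite !addn0.
Qed.

End Extrema.

Arguments local_bundle_cup {F n}.
Arguments local_bundle_cap {F n}.

(** * Sums over words cut into blocks *)

Lemma sum_tuple0 (V : nmodType) (T : finType) (f : seq T -> V) :
  \sum_(u : 0.-tuple T) f u = f [::].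
Proof.
rewrite (big_pred1 [tuple]) // => u; apply/esym/eqP; exact: tuple0.
Qed.

Lemma sum_tupleS (V : nmodType) (T : finType) k (f : seq T -> V) :
  \sum_(u : k.+1.-tuple T) f u = \sum_x \sum_(u : k.-tuple T) f (x :: u).
Proof.
rewrite pair_big /= (reindex (fun p : T * k.-tuple T =>
  [tuple of p.1 :: p.2])) //.
exists (fun u : k.+1.-tuple T => (thead u, [tuple of behead u])) =>
  [[x u]|u] _ /=.
  by congr (_, _); apply: val_inj.
by apply: val_inj; rewrite /= -[RHS]/(val u) {3}(tuple_eta u).
Qed.

Lemma sum_tupleD (V : nmodType) (T : finType) a b (f : seq T -> V) :
  \sum_(u : (a + b).-tuple T) f u =
  \sum_(u : a.-tuple T) \sum_(w : b.-tuple T) f (u ++ w).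
Proof.
elim: a f => [|a IH] f.
  by rewrite (sum_tuple0 (fun u => \sum_(w : b.-tuple T) f (u ++ w))).
rewrite addSn sum_tupleS (sum_tupleS _ (fun u =>
  \sum_(w : b.-tuple T) f (u ++ w))).
by apply: eq_bigr => x _; rewrite (IH (fun u => f (x :: u))).
Qed.

Lemma sum_tuple2 (V : nmodType) (T : finType) (f : seq T -> V) :
  \sum_(u : 2.-tuple T) f u = \sum_x \sum_y f [:: x; y].
Proof.
rewrite sum_tupleS; apply: eq_bigr => x _.
rewrite (sum_tupleS _ (fun u => f (x :: u))); apply: eq_bigr => y _.
exact: (sum_tuple0 (fun u => f [:: x, y & u])).
Qed.

Section Blocks.
Context (F : fieldType) (n : nat).
Implicit Types (Q : F) (f g : seq 'I_n -> F) (w : seq 'I_n).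

(** The [Q]-factorial, generating function of inversions over the orderings of [k] distinct
    letters. *)
Definition block_fact Q k : F := \prod_(0 <= j < k) \sum_(0 <= i < j.+1) Q ^+ i.

(** A set of letters per block encodes a word increasing in each block, because [enum S] is
    increasing; different blocks are not compared. *)
Fixpoint block_sum (ks : seq nat) f : F :=
  if ks is k :: ks' then
    \sum_(S : {set 'I_n} | #|S| == k) block_sum ks' (fun w => f (enum S ++ w))
  else f [::].

Lemma block_sum_eq ks f g : (forall w, size w = sumn ks -> f w = g w) ->
  block_sum ks f = block_sum ks g.
Proof.
elim: ks f g => [|k ks IH] f g fg /=; first exact: fg.
apply: eq_bigr => S /eqP cS; apply: IH => w sw.
by apply: fg; rewrite size_cat -cardE cS sw.
Qed.

Lemma block_sum_sum (I : finType) ks (h : I -> seq 'I_n -> F) (c : I -> F) :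
  \sum_i block_sum ks (h i) * c i = block_sum ks (fun w => \sum_i h i w * c i).
Proof.
elim: ks h => [|k ks IH] h //=.
under eq_bigr do rewrite mulr_suml.
rewrite exchange_big; apply: eq_bigr => S _.
exact: (IH (fun i w => h i (enum S ++ w))).
Qed.

(** Each smaller letter that [x] passes on its way left creates one inversion, at the price of one
    factor [Q]. *)
Lemma move_left Q k g (x : 'I_n) p l1 l2 :
  (forall a (y z : 'I_n) b, (y < z)%N -> (size a + size b).+2 = k ->
     g (a ++ [:: z, y & b]) = Q * g (a ++ [:: y, z & b])) ->
  (size p + size l1 + size l2).+1 = k -> all (fun y : 'I_n => y < x)%N l1 ->
  g (p ++ x :: l1 ++ l2) = Q ^+ size l1 * g (p ++ l1 ++ x :: l2).
Proof.
move=> gS; elim: l1 p => [|y l1 IH] p /=; first by rewrite mul1r.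
move=> sz /andP[yx al]; rewrite gS //; last by rewrite size_cat; lia.
rewrite exprS -mulrA; congr (_ * _).
rewrite -cat1s catA IH //; last by rewrite size_cat /=; lia.
by rewrite -catA.
Qed.

Lemma ord_lt_trans : transitive (fun x y : 'I_n => x < y)%N.
Proof. by move=> y x z; apply: ltn_trans. Qed.

Lemma sorted_enum (S : {set 'I_n}) : sorted (fun x y : 'I_n =>
  x < y)%N (enum S).
Proof.
rewrite /enum_mem; apply: sorted_filter; first exact: ord_lt_trans.
rewrite -enumT -(@sorted_map _ _ val ltn) val_enum_ord; exact: iota_ltn_sorted.
Qed.

(** Putting [x] in front of the remaining letters creates as many inversions as [x] has predecessors
    in [S], namely its index in [enum S]. *)
Lemma sum_extract Q g (S : {set 'I_n}) :
  (forall a (y z : 'I_n) b, (y < z)%N -> (size a + size b).+2 = #|S| ->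
     g (a ++ [:: z, y & b]) = Q * g (a ++ [:: y, z & b])) ->
  \sum_(x in S) g (x :: enum (S :\ x)) =
  (\sum_(0 <= i < #|S|) Q ^+ i) * g (enum S).
Proof.
move=> gS; rewrite -big_enum /=.
have -> : \sum_(x <- enum S) g (x :: enum (S :\ x)) =
    \sum_(x <- enum S) Q ^+ index x (enum S) * g (enum S).
  rewrite !big_seq; apply: eq_bigr => x xS.
  have -> : enum (S :\ x) = rem x (enum S).
    rewrite rem_filter ?enum_uniq // /enum_mem -filter_predI /=.
    by apply: eq_filter => y; rewrite !inE.
  have := sorted_enum S; have := enum_uniq (mem S).
  have : size (enum S) = #|S| by rewrite cardE.
  case/splitPr: xS => l1 l2 sz uS; rewrite (sorted_pairwise ord_lt_trans).
  rewrite pairwise_cat => /and3P[+ _ _].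
  rewrite allrel_consr => /andP[al _].
  move: uS; rewrite cat_uniq /= => /and3P[_ /norP[xl1 _] /andP[xl2 _]].
  rewrite remE index_cat (negPf xl1) /= eqxx addn0 take_size_cat //.
  rewrite drop_cat ltnNge leqnSn /= subSnn /= drop0.
  apply: (move_left (p := [::]) gS) => //=.
  by rewrite -sz size_cat /= addnS.
rewrite -big_distrl /=; congr (_ * _); rewrite cardE.
move: (enum S) (enum_uniq (mem S)) => [|x0 l] ul;
  first by rewrite big_nil big_geq.
rewrite (big_nth x0) !big_nat; apply: eq_bigr => i /andP[_ il].
by rewrite index_uniq.
Qed.

(** Induction on the length: the letters after the first are sorted by the induction hypothesis,
    then the first one is inserted among them by [sum_extract], giving the last factor of the
    [Q]-factorial. *)
Lemma sum_block Q k g :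
  (forall a (y z : 'I_n) b, (y < z)%N -> (size a + size b).+2 = k ->
     g (a ++ [:: z, y & b]) = Q * g (a ++ [:: y, z & b])) ->
  (forall u, ~~ uniq u -> g u = 0) ->
  \sum_(u : k.-tuple 'I_n) g u =
  block_fact Q k * \sum_(S : {set 'I_n} | #|S| == k) g (enum S).
Proof.
elim: k g => [|k IH] g gS gU.
  rewrite sum_tuple0 /block_fact big_geq // mul1r (big_pred1 set0) ?enum_set0
    //.
  by move=> S; rewrite cards_eq0.
rewrite sum_tupleS /block_fact big_nat_recr //= -/(block_fact Q k) -mulrA.
have -> : \sum_x \sum_(u : k.-tuple 'I_n) g (x :: u) =
    \sum_x block_fact Q k * \sum_(S : {set 'I_n} | #|S| == k) g (x :: enum S).
  apply: eq_bigr => x _;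
    rewrite (IH (fun u => g (x :: u))) // => [a y z b yz sz|u uu].
    by rewrite (gS (x :: a)) //= -sz.
  by apply: gU; rewrite /= negb_and uu orbT.
rewrite -mulr_sumr; congr (_ * _).
(* A pair of [x] and a set avoiding it is the same as a larger set with a marked element; when [x]
   lies in the set, the word repeats a letter and contributes 0. *)
have -> : \sum_x \sum_(S : {set 'I_n} | #|S| == k) g (x :: enum S) =
    \sum_x \sum_(S : {set 'I_n} | (#|S| == k.+1) && (x \in S)) g (x :: enum (S
      :\ x)).
  apply: eq_bigr => x _;
    rewrite (bigID (fun S : {set 'I_n} => x \in S)) /= big1 ?add0r.
    rewrite [RHS](reindex_onto (fun S : {set 'I_n} => x |: S) (fun S =>
      S :\ x)) /=.
      apply: eq_big => [S|S /andP[_ xS]]; last by rewrite setU1K.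
      rewrite setU11 andbT; have [xS|xS] /= := boolP (x \in S);
        rewrite ?andbF ?andbT.
        by apply/esym/negbTE/negP => /andP[_ /eqP eS];
          rewrite -eS !inE eqxx in xS.
      by rewrite cardsU1 xS eqSS setU1K // eqxx andbT.
    by move=> S /andP[_ xS]; rewrite setD1K.
  by move=> S /andP[_ xS]; apply: gU; rewrite /= mem_enum xS.
rewrite (exchange_big_dep (fun S : {set 'I_n} => #|S| == k.+1)) /=;
  last by move=> x S _ /andP[].
rewrite mulr_sumr; apply: eq_bigr => S /eqP cS.
rewrite -cS -sum_extract; last by rewrite cS.
by apply: eq_bigl => x; rewrite cS eqxx.
Qed.

Lemma sum_blocks Q ks f :
  (forall ks1 k ks2 a (x y : 'I_n) b, ks = ks1 ++ k :: ks2 ->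
     (sumn ks1 <= size a)%N -> ((size a).+2 <= sumn ks1 + k)%N ->
     (x < y)%N -> (size a + size b).+2 = sumn ks ->
     f (a ++ [:: y, x & b]) = Q * f (a ++ [:: x, y & b])) ->
  (forall w, ~~ uniq w -> f w = 0) ->
  \sum_(u : (sumn ks).-tuple 'I_n) f u =
  (\prod_(k <- ks) block_fact Q k) * block_sum ks f.
Proof.
elim: ks f => [|k ks IH] f fS fU; first by rewrite big_nil mul1r /= sum_tuple0.
rewrite /= sum_tupleD exchange_big big_cons /=.
have -> : \sum_(w : (sumn ks).-tuple 'I_n) \sum_(u : k.-tuple 'I_n) f (u ++ w) =
    \sum_(w : (sumn ks).-tuple 'I_n) block_fact Q k *
      \sum_(S : {set 'I_n} | #|S| == k) f (enum S ++ w).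
  apply: eq_bigr => w _;
    apply: (sum_block (g := fun u => f (u ++ w))) => [a y z b yz sz|u uu].
    rewrite -!catA /= (fS [::] k ks) //=; first by rewrite add0n -sz; lia.
    by rewrite size_cat size_tuple -sz; lia.
  by apply: fU; rewrite cat_uniq negb_and uu.
rewrite -mulr_sumr -mulrA; congr (_ * _); rewrite exchange_big mulr_sumr.
apply: eq_bigr => S /eqP cS.
rewrite (IH (fun w => f (enum S ++ w))) // =>
  [ks1 k' ks2 a x y b eks le1 le2 xy sz|w uw].
  rewrite catA (fS (k :: ks1) k' ks2) ?eks //= ?size_cat -?cardE ?cS; try lia.
    by rewrite -catA.
  by rewrite -eks; lia.
by apply: fU; rewrite cat_uniq !negb_and uw !orbT.
Qed.

End Blocks.

(** * Vertices *)

Section Vertices.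
Context (F : fieldType) (n : nat) (q : F) (q0 : q != 0).
Implicit Types (v f g : seq 'I_n -> F) (w : seq 'I_n).

Fixpoint word_inv (w : seq 'I_n) : nat :=
  if w is x :: w' then count (fun y : 'I_n => y < x)%N w' + word_inv w' else 0.

Lemma word_inv_map (s : 'I_n -> 'I_n) (l : seq 'I_n) :
  sorted (fun x y : 'I_n => x < y)%N l ->
  word_inv [seq s i | i <- l] =
  (\sum_(i <- l) \sum_(j <- l) ((i < j) && (s j < s i)))%N.
Proof.
elim: l => [|x l IH]; first by rewrite big_nil.
move=> srt; have /= /IH {}IH := path_sorted srt.
have /allP xl : all (fun y : 'I_n => x < y)%N l.
  by apply: order_path_min srt; apply: ord_lt_trans.
rewrite /= IH big_cons big_cons ltnn add0n; congr (_ + _)%N.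
  rewrite count_map -sum1_count big_mkcond big_seq [RHS]big_seq.
  by apply: eq_bigr => y /xl -> /=; case: ifP.
rewrite big_seq [RHS]big_seq; apply: eq_bigr => y /xl xy.
by rewrite big_cons ltnNge (ltnW xy).
Qed.

Lemma inversions_word (s : 'S_n) :
  inversions s = word_inv [seq s i | i <- enum 'I_n].
Proof.
rewrite word_inv_map; last first.
  by rewrite -(@sorted_map _ _ val ltn) val_enum_ord; apply: iota_ltn_sorted.
rewrite /inversions -sum1_card big_mkcond /= !big_enum.
under [RHS]eq_bigr do rewrite big_enum.
rewrite pair_big /=; apply: eq_bigr => p _.
by rewrite inE; case: ifP.
Qed.

Lemma Tcoef_rep w : ~~ uniq w -> Tcoef q w = 0.
Proof.
move=> uw; apply: big1 => s _; case: eqP => [ew|_]; last by rewrite mulr0.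
by move: uw; rewrite ew map_inj_uniq ?enum_uniq //; apply: perm_inj.
Qed.

(** A repetition-free word of length [n] comes from exactly one permutation, so a single term of the
    defining sum survives. *)
Lemma Tcoef_word w : size w = n ->
  Tcoef q w = if uniq w then (- q) ^+ word_inv w else 0.
Proof.
move=> sw; case: ifP => uw; last first.
  by apply: Tcoef_rep; rewrite uw.
pose tw : n.-tuple 'I_n := tcast sw (in_tuple w).
have twE : tval tw = w by rewrite val_tcast.
have inj : injective (tnth tw) by apply/tuple_uniqP; rewrite twE.
pose s0 := perm inj.
have ew : w = [seq s0 i | i <- enum 'I_n].
  by rewrite -twE -[LHS](map_tnth_enum tw); apply: eq_map => i; rewrite permE.
rewrite /Tcoef (bigD1 s0) //= -ew eqxx mulr1 inversions_word -ew big1 ?addr0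
  // => s ss0.
case: eqP => [es|_]; last by rewrite mulr0.
case/eqP: ss0; apply/permP => i; move: es; rewrite {1}ew => /eq_in_map -> //.
by rewrite mem_enum.
Qed.

Lemma word_inv_swap a (x y : 'I_n) b : (x < y)%N ->
  word_inv (a ++ [:: y, x & b]) = (word_inv (a ++ [:: x, y & b])).+1.
Proof.
move=> xy; elim: a => [|z a IH] /=; first by rewrite xy ltnNge (ltnW xy) /=;
  lia.
rewrite IH !count_cat /=; lia.
Qed.

Lemma uniq_swap (T : eqType) (a : seq T) x y b :
  uniq (a ++ [:: y, x & b]) = uniq (a ++ [:: x, y & b]).
Proof.
apply: perm_uniq; rewrite perm_cat2l -(cat1s y) -(cat1s x b).
by rewrite -[[:: x, y & b]]/([:: x] ++ [:: y] ++ b) perm_catCA.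
Qed.

Lemma Tcoef_swap a (x y : 'I_n) b : (x < y)%N -> (size a + size b).+2 = n ->
  Tcoef q (a ++ [:: y, x & b]) = - q * Tcoef q (a ++ [:: x, y & b]).
Proof.
move=> xy sz; have s x' y' : size (a ++ [:: x', y' & b]) = n.
  rewrite size_cat /=; lia.
rewrite !Tcoef_word // uniq_swap word_inv_swap // exprS.
by case: ifP; rewrite ?mulr0.
Qed.

Definition black_op v w : F := \sum_(u : n.-tuple 'I_n) Tcoef q u * v (u ++ w).

(** The tensor [xi] is a parameter because T_+ will be replaced by basis tensors and by reduced
    tensors. *)
Definition white_op (xi : seq 'I_n ->
  F) v w : F := xi (take n w) * v (drop n w).

Lemma lin_black : lin black_op.
Proof.
move=> c d f g w; rewrite /black_op !mulr_sumr -big_split /=.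
by apply: eq_bigr => u _; ring.
Qed.

Lemma local_black : local n 0 black_op.
Proof.
by move=> f g [] // z _ fg; apply: eq_bigr => u _;
  rewrite cats0 fg // size_tuple.
Qed.

Lemma lin_white xi : lin (white_op xi).
Proof. by move=> c d f g w; rewrite /white_op; ring. Qed.

Lemma local_white xi : local 0 n (white_op xi).
Proof.
move=> f g w z sw fg; rewrite /white_op take_size_cat // drop_size_cat //.
by rewrite take_oversize ?drop_oversize ?sw // -fg.
Qed.

(** For x < y the image under H has no diagonal term, so a basis word goes to a single basis word;
    this motivates using R^-1 rather than R in [hecke]. *)
Lemma hecke_delta a (x y : 'I_n) b w : (x < y)%N ->
  size w = (size a + size b).+2 ->
  at_pos (size a) (hecke q false) (fun u => (u == a ++ [:: x, y & b])%:R) w =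
  (w == a ++ [:: y, x & b])%:R.
Proof.
move=> xy sw; rewrite -(cat_take_drop (size a) w).
have sa : size (take (size a) w) = size a by rewrite size_takel // sw; lia.
have : size (drop (size a) w) = (size b).+2 by rewrite size_drop sw; lia.
move: (take _ _) (drop _ _) sa => a' [|k [|l b']] // sa _.
rewrite -{1}sa -[size a']addn0 at_pos_cat /hecke /at_pos /=.
rewrite !eqseq_cat //= -!val_eqE /=.
have [_|_] := eqVneq a' a; last by rewrite /= !mulr0 addr0 if_same mulr0.
rewrite !andTb !eqseq_cons mul1r.
have /negPf xny : x != y by rewrite -val_eqE neq_ltn xy.
case: ifP => [/eqP/val_inj->|_].
  have [->|_] := eqVneq l x; last by rewrite /= mulr0 andbF.
  by rewrite xny /= mulr0.
have -> : (if (k < l)%N then 0 else - (q - q^-1)) *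
    ((k == x) && ((l == y) && (b' == b)))%:R = 0.
  have [->|_] := eqVneq k x; last by rewrite mulr0.
  have [->|_] := eqVneq l y; last by rewrite mulr0.
  by rewrite xy mul0r.
by rewrite addr0 andbCA.
Qed.

Lemma at_white a xi f : eq_from a (at_pos a (white_op xi) f)
  (fun w => xi (take n (drop a w)) * f (take a w ++ drop (a + n) w)).
Proof.
elim: a f => [|a IH] f w; first by rewrite /at_pos /white_op drop0 take0 add0n.
case: w => [|x w] // sw.
exact: (IH (fun u => f (x :: u)) w sw).
Qed.

Lemma hecke_white c xi f : (c + 2 <= n)%N ->
  eq_from n (at_pos c (hecke q false) (white_op xi f))
    (white_op (at_pos c (hecke q false) xi) f).
Proof.
move=> cn w sw; have lc := local_at_pos c (@local_hecke F n q false).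
have {}lc : @local F n n n (at_pos c (hecke q false)).
  by have := local_widen (n - (c + 2)) lc; rewrite subnKC //; apply.
have s1 : size (take n w) = n by rewrite size_takel.
rewrite -{1}(cat_take_drop n w) (local_slice _ _ lc s1) /white_op mulrC.
rewrite -linZ; last exact: lin_at_pos (lin_hecke _ _).
have := lc _ (fun u => f (drop n w) * xi u) (take n w) [::] s1; rewrite cats0;
  apply=> u su.
by rewrite cats0 take_size_cat // drop_size_cat // mulrC.
Qed.

(** After renaming the letters in the exchanged terms, the coefficient of [g x y] is T y x + d x y *
    T x y. By [Tcoef_swap] this equals -q * T x y for either order of distinct letters, and for
    equal letters [T] vanishes. *)
Lemma black_absorb r v w : (r + 2 <= n)%N ->
  black_op (at_pos r (hecke q false) v) w = - q * black_op v w.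
Proof.
move=> rn; rewrite /black_op.
have [k ek] : exists k, n = (r + (2 + k))%N by exists (n - r - 2)%N; lia.
have split (f : seq 'I_n -> F) : \sum_(u : n.-tuple 'I_n) f u =
    \sum_(a : r.-tuple 'I_n) \sum_(b : k.-tuple 'I_n) \sum_x \sum_y f (a ++
      [:: x, y & b]).
  have -> : \sum_(u : n.-tuple 'I_n) f u =
    \sum_(u : (r + (2 + k)).-tuple 'I_n) f u.
    by case: _ / ek.
  rewrite sum_tupleD; apply: eq_bigr => a _.
  rewrite (sum_tupleD _ _ (fun u => f (a ++ u))) exchange_big;
    apply: eq_bigr => b _.
  exact: (sum_tuple2 (fun u => f (a ++ u ++ b))).
rewrite (split (fun u => Tcoef q u * at_pos r (hecke q false) v (u ++ w))).
rewrite (split (fun u => Tcoef q u * v (u ++ w))) !mulr_sumr.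
apply: eq_bigr => a _; rewrite mulr_sumr; apply: eq_bigr => b _.
pose T x y := Tcoef q (a ++ [:: x, y & b]);
  pose g x y := v ((a ++ [:: x, y & b]) ++ w).
have sz : (size a + size b).+2 = n by rewrite !size_tuple; lia.
have Tsw (x y : 'I_n) : (x < y)%N -> T y x = - q * T x y by move=> xy;
  apply: Tcoef_swap.
have Txx x : T x x = 0.
  by apply: Tcoef_rep; rewrite cat_uniq /= inE eqxx /= !andbF.
pose d (x y : 'I_n) := if (x < y)%N then 0 else - (q - q^-1).
have Hv x y : at_pos r (hecke q false) v ((a ++ [:: x, y & b]) ++ w) =
    if x == y then q^-1 * g x y else g y x + d x y * g x y.
  rewrite -{1}(size_tuple a) -[size a]addn0 -catA at_pos_cat /hecke /at_pos /=
    mul1r.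
  by rewrite /g -!catA.
have -> : \sum_x \sum_y T x y * at_pos r (hecke q false) v ((a ++ [:: x,
  y & b]) ++ w) =
    \sum_x \sum_y ((x != y)%:R * T x y * g y x + T x y * d x y * g x y).
  apply: eq_bigr => x _; apply: eq_bigr => y _; rewrite Hv.
  by case: eqP => [->|_] /=; rewrite ?Txx; ring.
under eq_bigr do rewrite big_split.
rewrite big_split exchange_big -big_split mulr_sumr; apply: eq_bigr => x _.
rewrite -big_split mulr_sumr; apply: eq_bigr => y _.
rewrite /= -/(T x y) -/(g x y) /d eq_sym -val_eqE.
case: (ltngtP x y) => [xy|yx|/val_inj ->] /=; last by rewrite Txx; ring.
  by rewrite (Tsw _ _ xy); ring.
by rewrite (Tsw _ _ yx); field; rewrite q0.
Qed.

End Vertices.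

(** * Sliding along an edge of the graph *)

Lemma cat_cons_cat (T : Type) (l r A B : seq T) x : l ++ x :: r = A ++ B ->
  (exists r', A = l ++ x :: r' /\ r = r' ++ B) \/
  (exists l', l = A ++ l' /\ B = l' ++ x :: r).
Proof.
elim: A l => [|a A IH] [|b l] /=; first by right; exists [::].
- by right; exists (b :: l).
- by case=> -> ->; left; exists A.
case=> -> /IH [[r' [-> ->]]|[l' [-> ->]]]; first by left; exists r'.
by right; exists l'.
Qed.

Lemma cat_cons_cat3 (T : Type) (l r A B C : seq T) x :
  A ++ B ++ C = l ++ x :: r ->
  [\/ exists r', A = l ++ x :: r' /\ r = r' ++ B ++ C,
      exists l' r', [/\ l = A ++ l', B = l' ++ x :: r' & r = r' ++ C] |
      exists l', l = A ++ B ++ l' /\ C = l' ++ x :: r].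
Proof.
move=> e; have [[r' [eA er]]|[l' [el e']]] := cat_cons_cat (esym e).
  by apply: Or31; exists r'.
case: (cat_cons_cat (esym e')) => [[r' [eB er]]|[l'' [el' eC]]];
  first by apply: Or32; exists l', r'.
by apply: Or33; exists l''; rewrite el el' catA.
Qed.

Lemma stacked_rcons (S P : Type) (src tgt : P -> seq S) a ds s b :
  stacked src tgt a (rcons ds s) b <->
  stacked src tgt a ds (lower src s) /\ upper tgt s = b.
Proof.
elim: ds a => [|s' ds IH] a /=; first by split=> -[].
by have := IH (upper tgt s'); tauto.
Qed.

Section GraphOperators.
Context (F : fieldType) (n : nat) (q t : F) (q0 : q != 0) (t0 : t != 0).
Context (G : bigraph) (m : edge G -> 'I_n.+1) (mw : multiweb m).
Notation tensor := (seq 'I_n -> F).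
Implicit Types (theta : wvert G -> seq (strand G) -> tensor) (v f g : tensor).
Implicit Types (s : graph_strip G) (ds : seq (graph_strip G)).

Notation width ss := (size (split_line m ss)).
Notation gstacked := (stacked (@graph_src G) (@graph_tgt G)).
Notation ok := (all (fun s : graph_strip G => graph_piece_ok (piece s))).

(* [theta v ss] replaces the tensor [T_+] at the white vertex [v]. *)
Definition graph_op theta (p : graph_piece G) : tensor -> tensor :=
  match p with
  | GCross o x y => bundle_cross q t o (m x.1) (m y.1)
  | GCup b e _ => bundle_cup q b (m e)
  | GCap b e _ => bundle_cap q b (m e)
  | GBlack _ _ => black_op q
  | GWhite v ss => white_op (theta v ss)
  end.

Definition graph_step theta v s : tensor :=
  at_pos (width (lft s)) (graph_op theta (piece s)) v.

Definition graph_run theta ds v : tensor := foldl (graph_step theta) v ds.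

Lemma width_cat ss1 ss2 : width (ss1 ++ ss2) = (width ss1 + width ss2)%N.
Proof. by rewrite split_line_cat size_cat. Qed.

Lemma width_cons x ss : width (x :: ss) = (m x.1 + width ss)%N.
Proof. by rewrite /split_line /= size_cat size_nseq. Qed.

Lemma width_nil : width [::] = 0%N.
Proof. by []. Qed.

Lemma width_edges (ss : seq (strand G)) :
  width ss = (\sum_(e <- [seq x.1 | x <- ss]) m e)%N.
Proof. by elim: ss => [|x ss IH];
  rewrite ?big_nil // width_cons IH big_cons. Qed.

Lemma width_black (u : bvert G) es : graph_piece_ok (GBlack u es) ->
  width (graph_src (GBlack u es)) = n.
Proof.
move=> /= pes; rewrite width_edges -map_comp map_id_in //.
by rewrite (perm_big _ pes) big_enum /=; case: mw => ->.
Qed.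

Lemma width_white (u : wvert G) ss : graph_piece_ok (GWhite u ss) ->
  width ss = n.
Proof.
move=> /= /andP[_ pes]; rewrite width_edges.
by rewrite (perm_big _ pes) big_enum /=; case: mw => _ ->.
Qed.

Lemma lin_graph_op theta p : lin (graph_op theta p).
Proof.
case: p => [o x y|b e k|b e k|v es|v ss] /=.
- exact: lin_bundle_cross.
- exact: lin_bundle_cup.
- exact: lin_bundle_cap.
- exact: lin_black.
- exact: lin_white.
Qed.

Lemma local_graph_op theta p : graph_piece_ok p ->
  local (width (graph_src p)) (width (graph_tgt p)) (graph_op theta p).
Proof.
case: p => [o x y|b e k|b e k|v es|v ss] pok.
- rewrite /= !width_cons !width_nil !addn0 [(m y.1 + _)%N]addnC.
  exact: local_bundle_cross.
- rewrite /= /extremum; have := local_bundle_cup q b (m e).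
  by case: b pok => _; rewrite !width_cons !width_nil addn0.
- rewrite /= /extremum; have := local_bundle_cap q b (m e).
  by case: b pok => _; rewrite !width_cons !width_nil addn0.
- by rewrite width_black //; apply: local_black.
- by rewrite /= (width_white pok); apply: local_white.
Qed.

Lemma lin_graph_step theta s : lin (fun v => graph_step theta v s).
Proof. exact: lin_at_pos (lin_graph_op _ _). Qed.

Lemma local_graph_step theta s : graph_piece_ok (piece s) ->
  local (width (lower (@graph_src G) s)) (width (upper (@graph_tgt G) s))
    (fun v => graph_step theta v s).
Proof.
move=> sok; rewrite /lower /upper !width_cat !addnA.
exact: local_widen (local_at_pos _ (local_graph_op theta sok)).
Qed.

Lemma lin_graph_run theta ds : lin (graph_run theta ds).
Proof.
elim: ds => [|s ds IH]; first by move=> c d f g w.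
exact: lin_comp (lin_graph_step theta s) IH.
Qed.

Lemma local_graph_run theta ds a b : gstacked a ds b -> ok ds ->
  local (width a) (width b) (graph_run theta ds).
Proof.
elim: ds a => [|s ds IH] a /=; first by move=> -> _ f g w z sw fg; exact: fg.
move=> [<- st] /andP[sok dok].
exact: local_comp (local_graph_step theta sok) (IH _ st dok).
Qed.

Lemma graph_run_eq theta ds a f g : gstacked a ds [::] -> ok ds ->
  eq_from (width a) f g -> graph_run theta ds f [::] =
    graph_run theta ds g [::].
Proof. by move=> st dok fg;
  apply: (local_eq (local_graph_run theta st dok) fg). Qed.

Lemma graph_run_cons theta s ds v :
  graph_run theta (s :: ds) v = graph_run theta ds (graph_step theta v s).
Proof. by []. Qed.

Lemma graph_run_rcons theta s ds v :
  graph_run theta (rcons ds s) v = graph_step theta (graph_run theta ds v) s.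
Proof. by rewrite /graph_run -cats1 foldl_cat. Qed.

Lemma hecke_left theta s l x r p h v : lft s =
  l ++ x :: r -> (p + 2 <= m x.1)%N ->
  graph_step theta (at_pos (width l + p) (hecke q h) v) s =
  at_pos (width l + p) (hecke q h) (graph_step theta v s).
Proof.
move=> es pm; rewrite /graph_step hecke_commL //; first exact: lin_graph_op.
by rewrite es width_cat width_cons; lia.
Qed.

Lemma hecke_right theta s l p h v : graph_piece_ok (piece s) ->
  eq_from (width (upper (@graph_tgt G) s))
    (graph_step theta
      (at_pos (width (lft s ++ graph_src (piece s) ++ l) + p) (hecke q h) v) s)
    (at_pos (width (lft s ++ graph_tgt (piece s) ++ l) + p) (hecke q h)
      (graph_step theta v s)).
Proof.
move=> sok; rewrite /upper.
have e ss : (width (lft s ++ ss ++ l) + p =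
    width (lft s) + width ss + (width l + p))%N by rewrite !width_cat; lia.
rewrite !e; have le : (width (lft s) + width (graph_tgt (piece s)) <=
    width (lft s ++ graph_tgt (piece s) ++ rgt s))%N by rewrite !width_cat; lia.
apply: (eq_from_le le).
exact: hecke_commR (lin_at_pos _ (lin_graph_op theta _))
  (local_at_pos _ (local_graph_op theta sok)).
Qed.

Lemma hecke_cross theta s o x y l z r p v : piece s = GCross o x y ->
  [:: x; y] = l ++ z :: r -> (p + 2 <= m z.1)%N ->
  exists l' r', [:: y; x] = l' ++ z :: r' /\
  eq_from (width (upper (@graph_tgt G) s))
    (graph_step theta (at_pos (width (lft s ++ l) + p) (hecke q false) v) s)
    (at_pos (width (lft s ++ l') + p) (hecke q false) (graph_step theta v s)).
Proof.
move=> ps exy pm; rewrite /upper /graph_step ps /=.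
have le : (width (lft s) + (m x.1 + m y.1) <= width (lft s ++ [:: y;
  x] ++ rgt s))%N.
  by rewrite !width_cat !width_cons; lia.
case: l exy => [|a [|b l]] /=; last by case: l.
- case=> ex _; exists [:: y], [::]; rewrite ex; split=> //;
  rewrite -ex in pm le *.
  apply: (eq_from_le le);
    rewrite !width_cat width_cons !width_nil !addn0 -addnA !(at_pos_add (width
      _)) -!at_pos_comp.
  apply: eq_from_at_pos => f.
  exact: bundle_cross_slide_left.
- case=> ex ey _; exists [::], [:: x]; rewrite ey; split=> //;
  rewrite -ey in pm le *.
  apply: (eq_from_le le);
    rewrite -ex !width_cat width_cons !width_nil !addn0 -addnA !(at_pos_add
      (width _)) -!at_pos_comp.
  apply: eq_from_at_pos => f.
  exact: bundle_cross_slide_right.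
Qed.

Lemma hecke_cap theta s b e k h r c v : piece s = GCap b e k ->
  (r + 2 + c)%N = m e ->
  eq_from (width (lft s))
    (graph_step theta (at_pos (width (lft s) + r) (hecke q h) v) s)
    (graph_step theta
      (at_pos (width (lft s) + (r + 2 + (c + c))) (hecke q (~~ h)) v) s).
Proof.
move=> ps me; rewrite /graph_step ps /= -me.
rewrite 2!(at_pos_add (width _)) -!at_pos_comp.
have := @eq_from_at_pos _ _ (width (lft s)) 0; rewrite addn0; apply=> f.
exact: bundle_cap_slide.
Qed.

Lemma hecke_cup theta s b e k h r c v : piece s = GCup b e k ->
  (r + 2 + c)%N = m e ->
  eq_from (width (lft s) + (m e + m e))
    (at_pos (width (lft s) + r) (hecke q h) (graph_step theta v s))
    (at_pos (width (lft s) + (r + 2 + (c + c))) (hecke q (~~ h))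
      (graph_step theta v s)).
Proof.
move=> ps me; rewrite /graph_step ps /= -me.
rewrite 2!(at_pos_add (width _)) -!at_pos_comp.
apply: eq_from_at_pos => f; exact: bundle_cup_slide.
Qed.

Lemma hecke_black theta s u es p v : piece s = GBlack u es -> (p + 2 <= n)%N ->
  eq_from (width (lft s))
    (graph_step theta (at_pos (width (lft s) + p) (hecke q false) v) s)
    (fun w => - q * graph_step theta v s w).
Proof.
move=> ps pn; rewrite /graph_step ps /= at_pos_add -at_pos_comp.
elim: (width (lft s)) v => [|a IH] v w; first by rewrite /at_pos black_absorb.
by case: w => [|x w] // sw; apply: IH.
Qed.

Lemma stacked_step ds1 s ds2 : gstacked [::] ds1 (lower (@graph_src G) s) ->
  gstacked [::] (rcons ds1 s) (upper (@graph_tgt G) s).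
Proof. by move=> st; apply/stacked_rcons. Qed.

(* An even segment [k] is followed upwards, to the black vertex or to the cap  *)
(* which joins it to segment [k.-1], and an odd one downwards, to the cup.     *)
Lemma hecke_slide theta k e ds1 ds2 l r p :
  ok ds1 -> ok ds2 ->
  gstacked [::] ds1 (l ++ (e, k) :: r) ->
    gstacked (l ++ (e, k) :: r) ds2 [::] ->
  (p + 2 <= m e)%N ->
  forall v, graph_run theta ds2
    (at_pos (width l + p) (hecke q (odd k)) (graph_run theta ds1 v)) [::] =
  - q * graph_run theta ds2 (graph_run theta ds1 v) [::].
Proof.
move=> ok1 ok2 st1 st2 pm v.
(* The outer induction is on the segment; the inner ones run through the strips below (odd [k]) or
   above (even [k]) and start afresh once an extremum has been passed. *)
elim/ltn_ind: k ds1 ds2 l r p ok1 ok2 st1 st2 pm => k IHk ds1 ds2 l r p.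
have [kodd|keven] := boolP (odd k).
  elim/last_ind: ds1 ds2 l r p => [|ds1 s IH] ds2 l r p; first by case: l.
  rewrite all_rcons => /andP[sok ok1] ok2 /stacked_rcons[st1 us] st2 pm.
  rewrite graph_run_rcons; set f := graph_run theta ds1 v.
  have ok2' : ok (s :: ds2) by rewrite /= sok.
  have st2' : gstacked (lower (@graph_src G) s) (s :: ds2) [::] by rewrite /=
    us.
  case: (cat_cons_cat3 us) => [[r' [el er]]|[l' [r' [el et er]]]|[l' [el er]]].
  - rewrite -(hecke_left theta true f el pm) -graph_run_cons.
    apply: IH ok2' _ _ pm => //.
      by move: st1; rewrite /lower el -!catA /=; apply.
    by move: st2'; rewrite /lower el -!catA /=; apply.
  (* An upward strand cannot come out of a crossing or a white vertex, so only a cup remains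
     possible. *)
  - have down ss : all (fun x => ~~ upward x) ss -> ss <> l' ++ (e, k) :: r'.
      by move=> + ess; rewrite ess all_cat /= /upward kodd andbF.
    have st1' : gstacked [::] (rcons ds1 s) (l ++ (e, k) :: r) by rewrite -us;
      apply: stacked_step.
    have ok1' : ok (rcons ds1 s) by rewrite all_rcons sok.
    case ps : (piece s) sok et => [o x y|b e' k'|b e' k'|u es|u ss] /= sok' et.
    + by case: (down [:: y; x]) => //=; rewrite andbT andbC.
    + have nk : k' <> k by move=> ek; rewrite ek kodd in sok'.
      have wide : (width (lft s) + (m e' + m e') <= width (l ++ (e, k) :: r))%N.
        by rewrite -us /upper ps /= !width_cat; case: (b);
          rewrite !width_cons /=; lia.
      case: b ps et => ps; case: l' el {down} => [|a [|a' l']] el //= et;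
        try by case: et => // _ _; case: l' {el}.
      * case: et => ea ee ek er'; subst e' a.
        (* Nesting reverses the order of the copies: copies [p] and [p + 1] of one leg continue as
           copies m e - p - 1 and m e - p - 2 of the other. *)
        have er0 : ((m e - p - 2) + 2 + p)%N = m e by lia.
        have := hecke_cup theta false f ps er0 => /(eq_from_le wide).
        have -> : (width (lft s) + (m e - p - 2 + 2 + (p + p)) = width l + p)%N.
          by rewrite el width_cat width_cons width_nil /=; lia.
        move=> h; rewrite -(graph_run_eq theta st2 ok2 h) /f -graph_run_rcons.
        rewrite -us /upper ps /= in st1' st2.
        have ek' : odd k' = false by apply: negbTE.
        rewrite -ek'; apply: IHk st1' st2 _ => //; last by lia.
        by rewrite -ek.
      * case: et => ee ek er'; subst e'; rewrite cats0 in el; subst l.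
        have er0 : (p + 2 + (m e - p - 2))%N = m e by lia.
        have := hecke_cup theta true f ps er0 => /(eq_from_le wide) h.
        rewrite (graph_run_eq theta st2 ok2 h) /f -graph_run_rcons.
        have -> : (width (lft s) + (p + 2 + (m e - p - 2 + (m e - p - 2))) =
            width (lft s ++ [:: (e, k)]) + (m e - p - 2))%N.
          by rewrite width_cat width_cons width_nil /=; lia.
        rewrite -us /upper ps /= ek -(cat1s (e, k)) catA in st1' st2.
        have ek' : odd k' = false by apply: negbTE.
        rewrite [~~ _]/= -ek'; apply: IHk st1' st2 _ => //; last by lia.
        by rewrite -ek.
    + by case: l' et {el down}.
    + by case: l' et {el down}.
    + by case/andP: sok' => /down.
  - have := hecke_right theta l' p true f sok.
    rewrite -el us => /graph_run_eq <- //.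
    rewrite -graph_run_cons; apply: IH ok2' _ _ pm => //.
      by move: st1; rewrite /lower er -!catA; apply.
    by move: st2'; rewrite /lower er -!catA; apply.
elim: ds2 ds1 l r p => [|s ds2 IH] ds1 l r p; first by move=> _ _ _; case: l.
move=> ok1 /andP[sok ok2] st1 [ls st2] pm.
set f := graph_run theta ds1 v.
rewrite !graph_run_cons.
have ok1' : ok (rcons ds1 s) by rewrite all_rcons sok.
have st1' : gstacked [::] (rcons ds1 s) (upper (@graph_tgt G) s).
  by apply/stacked_rcons; rewrite ls.
case: (cat_cons_cat3 ls) => [[r' [el er]]|[l' [r' [el et er]]]|[l' [el er]]].
- rewrite (hecke_left theta false f el pm) -graph_run_rcons.
  apply: IH ok2 _ _ pm => //.
    by move: st1'; rewrite /upper el -!catA /=; apply.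
  by move: st2; rewrite /upper el -!catA /=; apply.
- case ps : (piece s) et => [o x y|b e' k'|b e' k'|u es|u ss] //= et.
  + have [l2 [r2 [e2]]] := hecke_cross theta f ps et pm.
    rewrite -el => /graph_run_eq -> //; rewrite -graph_run_rcons.
    apply: IH ok2 _ _ pm => //.
    + by move: st1'; rewrite /upper ps [graph_tgt _]/= e2 -!catA /=; apply.
    + by move: st2; rewrite /upper ps [graph_tgt _]/= e2 -!catA /=; apply.
  + by case: l' et {el}.
  (* The cap joins the odd segment [k'] to [k'.+1]; as [k] is even it is the latter, and the outer
     induction hypothesis is available for [k']. *)
  + have kk : odd k' by move: sok; rewrite ps.
    have nk : k' <> k by move=> ek; rewrite -ek kk in keven.
    have wide : (width (lft s) <= width (upper (@graph_tgt G) s))%N.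
      by rewrite /upper !width_cat; lia.
    case: b ps et => ps; case: l' el => [|a [|a' l']] el //= et;
      try by case: et => // _ _; case: l' {el}.
    * case: et => ea ee ek er'; subst e' a.
      have er0 : ((m e - p - 2) + 2 + p)%N = m e by lia.
      have := hecke_cap theta true f ps er0 => /(eq_from_le wide).
      have -> : (width (lft s) + (m e - p - 2 + 2 + (p + p)) = width l + p)%N.
        by rewrite el width_cat width_cons width_nil /=; lia.
      move=> h; rewrite -(graph_run_eq theta st2 ok2 h) -!graph_run_cons /f.
      have st2' : gstacked (lower (@graph_src G) s) (s :: ds2) [::] by [].
      rewrite -ls in st1.
      rewrite /lower ps [graph_src _]/= !cat_cons cat0s in st1 st2'.
      have ek' : odd k' = true by [].
      rewrite -ek'; apply: IHk st1 st2' _ => //=; last by lia.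
        by rewrite -ek.
      by rewrite sok.
    * case: et => ee ek er'; subst e'; rewrite cats0 in el; subst l.
      have er0 : (p + 2 + (m e - p - 2))%N = m e by lia.
      have := hecke_cap theta false f ps er0 => /(eq_from_le wide) h.
      rewrite (graph_run_eq theta st2 ok2 h) -!graph_run_cons /f.
      have -> : (width (lft s) + (p + 2 + (m e - p - 2 + (m e - p - 2))) =
          width (lft s ++ [:: (e, k)]) + (m e - p - 2))%N.
        by rewrite width_cat width_cons width_nil /=; lia.
      have st2' : gstacked (lower (@graph_src G) s) (s :: ds2) [::] by [].
      rewrite -ls in st1.
      rewrite /lower ps [graph_src _]/= !cat_cons cat0s ek -(cat1s (e, k)) catA
        in st1 st2'.
      have ek' : odd k' = true by [].
      rewrite [~~ _]/= -ek'; apply: IHk st1 st2' _ => //=; last by lia.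
        by rewrite -ek.
      by rewrite sok.
  (* The slide ends here: T_- absorbs H, and the scalar -q passes through the remaining strips by
     linearity. *)
  + have := width_black (u := u) (es := es); rewrite ps in sok => /(_ sok).
    rewrite /= et width_cat width_cons /= => wn.
    have pn : (width l' + p + 2 <= n)%N by move: pm wn => /=; clear; lia.
    have := hecke_black theta f ps pn; rewrite addnA -width_cat -el => h.
    have le : (width (lft s) <= width (upper (@graph_tgt G) s))%N.
      by rewrite /upper !width_cat; lia.
    rewrite (graph_run_eq _ st2 ok2 (eq_from_le le h)).
    by rewrite linZ //; apply: lin_graph_run.
  + by case: l' et {el}.
- have := hecke_right theta l' p false f sok.
  rewrite -el => /graph_run_eq -> //.
  rewrite -graph_run_rcons; apply: IH ok2 _ _ pm => //.
    by move: st1'; rewrite /upper er -!catA; apply.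
  by move: st2; rewrite /upper er -!catA; apply.
Qed.

End GraphOperators.

(** * Reduction at a white vertex *)

Lemma map_eq_cat_cons (A B : Type) (h : A -> B) ss ks1 k ks2 :
  [seq h x | x <- ss] = ks1 ++ k :: ks2 ->
  exists s1 x s2, [/\ ss = s1 ++ x :: s2, [seq h x | x <- s1] = ks1 & h x = k].
Proof.
elim: ks1 ss => [|k1 ks1 IH] [|y ss] //=.
  by case=> <- _; exists [::], y, ss.
by case=> <- /IH [s1 [x [s2 [-> <- <-]]]]; exists (y :: s1), x, s2.
Qed.

Lemma stacked_middle (S P : Type) (src tgt : P -> seq S) a d1 s d2 b :
  stacked src tgt a (d1 ++ s :: d2) b ->
  stacked src tgt a d1 (lower src s) /\ stacked src tgt (upper tgt s) d2 b.
Proof.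
by elim: d1 a => [|s' d1 IH] a /= [<- h] //; case: (IH _ h).
Qed.

Section WhiteVertices.
Context (F : fieldType) (n : nat) (q t : F) (q0 : q != 0) (t0 : t != 0).
Context (G : bigraph) (m : edge G -> 'I_n.+1) (mw : multiweb m).
Notation tensor := (seq 'I_n -> F).
Implicit Types (theta : wvert G -> seq (strand G) -> tensor) (v f g : tensor).
Implicit Types (s : graph_strip G) (ds : seq (graph_strip G)).
Notation width ss := (size (split_line m ss)).
Notation gstacked := (stacked (@graph_src G) (@graph_tgt G)).
Notation ok := (all (fun s : graph_strip G => graph_piece_ok (piece s))).

Lemma graph_run_agree theta theta' ds v :
  (forall u, u \in pmap (@white_of G) ds -> theta u = theta' u) ->
  graph_run q t m theta ds v = graph_run q t m theta' ds v.
Proof.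
elim: ds v => [|s ds IH] v agree //; rewrite /graph_run /=.
have -> : graph_step q t m theta v s = graph_step q t m theta' v s.
  rewrite /graph_step /graph_op;
    case ps : (piece s) => [o x y|b e k|b e k|u es|u ss] //.
  have uin : u \in pmap (@white_of G) (s :: ds) by rewrite /= [white_of
    s]/white_of ps /= inE eqxx.
  by rewrite (agree u uin).
apply: IH => u uds; apply: agree => /=.
by case: (white_of s) => [u'|] //=; rewrite inE uds orbT.
Qed.

Section WhiteVertex.
Context (theta : wvert G -> seq (strand G) -> tensor) (u0 : wvert G).
Context (ds1 ds2 : seq (graph_strip G)) (s : graph_strip G) (ss : seq (strand
  G)).
Context (ps : piece s = GWhite u0 ss) (dok : ok (ds1 ++ s :: ds2)).
Context (st : gstacked [::] (ds1 ++ s :: ds2) [::]).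
Context (nu1 : u0 \notin pmap (@white_of G) ds1).
Context (nu2 : u0 \notin pmap (@white_of G) ds2).
Context (v0 : tensor).

Let base := graph_run q t m theta ds1 v0.
Let a := width (lft s).
Let insert (xi : tensor) : tensor :=
  fun w => xi (take n (drop a w)) * base (take a w ++ drop (a + n) w).
(** The rest of the diagram seen as a linear functional of the tensor placed at [u0]. *)
Let value (xi : tensor) : F := graph_run q t m theta ds2 (insert xi) [::].

Let ok1 : ok ds1. Proof. by move: dok; rewrite all_cat => /andP[]. Qed.
Let sok : graph_piece_ok (piece s).
Proof. by move: dok; rewrite all_cat /= => /and3P[]. Qed.
Let ok2 : ok ds2. Proof. by move: dok; rewrite all_cat /= => /and3P[]. Qed.
Let wss : width ss = n.
Proof. by apply: (width_white mw (u := u0)); rewrite -ps; exact: sok. Qed.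
Let st1 : gstacked [::] (rcons ds1 s) (upper (@graph_tgt G) s).
Proof. by apply/stacked_rcons; case/stacked_middle: st. Qed.
Let st2 : gstacked (upper (@graph_tgt G) s) ds2 [::].
Proof. by case/stacked_middle: st. Qed.

Lemma value_run theta' : (forall u, u != u0 -> theta' u = theta u) ->
  graph_run q t m theta' (ds1 ++ s :: ds2) v0 [::] = value (theta' u0 ss).
Proof.
move=> agree; rewrite /value /graph_run foldl_cat /= -!/(graph_run _ _ _ _ _ _).
rewrite (@graph_run_agree theta' theta ds1); last first.
  by move=> u uds; apply: agree; apply: contraNneq nu1 => <-.
rewrite (@graph_run_agree theta' theta ds2); last first.
  by move=> u uds; apply: agree; apply: contraNneq nu2 => <-.
apply: (graph_run_eq q t mw theta st2 ok2); rewrite /graph_step ps /=.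
have le : (a <= width (upper (@graph_tgt G) s))%N.
  by rewrite /upper width_cat; apply: leq_addr.
exact: (eq_from_le le (at_white _ _)).
Qed.

Lemma value_expand xi : value xi =
  \sum_(u : n.-tuple 'I_n) xi u * value (fun w => (w == u)%:R).
Proof.
pose f w := \sum_(u : n.-tuple 'I_n) xi u * insert (fun w => (w == u)%:R) w.
have -> : value xi = graph_run q t m theta ds2 f [::].
  apply: (graph_run_eq q t mw theta st2 ok2) => w.
  rewrite /upper ps /= !width_cat wss -/a addnA => le.
  have sz : size (take n (drop a w)) == n.
    by rewrite size_takel // size_drop; lia.
  rewrite /f (bigD1 (Tuple sz)) //= /insert eqxx mul1r big1 ?addr0 // => u nu.
  case: eqP => [eu|_]; last by rewrite mul0r mulr0.
  by case/eqP: nu; apply: val_inj.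
rewrite (lin_sum _ _ (fun u : n.-tuple 'I_n => fun w =>
  xi u * insert (fun w => (w == u)%:R) w)); last exact: lin_graph_run.
by apply: eq_bigr => u _; rewrite linZ //; apply: lin_graph_run.
Qed.

Lemma value_eq xi xi' : (forall w, size w = n -> xi w = xi' w) -> value xi =
  value xi'.
Proof.
move=> h; rewrite value_expand [RHS]value_expand; apply: eq_bigr => u _.
by rewrite h // size_tuple.
Qed.

(** H placed just above the white vertex acts on [xi] by [hecke_white]; on the other hand
    [hecke_slide] carries it along the edge of [x] to the black end. *)
Lemma value_hecke xi (s1 s2 : seq (strand G)) x p : ss =
  s1 ++ x :: s2 -> (p + 2 <= m x.1)%N ->
  value (at_pos (width s1 + p) (hecke q false) xi) = - q * value xi.
Proof.
move=> ess pm; have cn : (width s1 + p + 2 <= n)%N.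
  by have := wss; rewrite ess width_cat width_cons; lia.
have xdown : odd x.2 = false.
  move: sok; rewrite ps /= ess all_cat /= => /andP[/and3P[_ ux _] _].
  exact: negbTE.
(* [hecke_slide] concerns a run from the bottom with one assignment of tensors, so [xi] is first
   made the tensor of [u0]. *)
pose theta' u ss' := if u == u0 then xi else theta u ss'.
have agree u : u != u0 -> theta' u = theta u.
  by rewrite /theta' => /negPf->; apply/funext.
have up : upper (@graph_tgt G) s = (lft s ++ s1) ++ (x.1, x.2) :: (s2 ++ rgt s).
  by rewrite /upper ps /= ess -!catA; case: (x).
have okr : ok (rcons ds1 s) by rewrite all_rcons sok.
have st1' := st1; have st2' := st2; rewrite up in st1' st2'.
have := hecke_slide q0 t0 mw theta' okr ok2 st1' st2' pm v0; rewrite xdown.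
have run2 f : graph_run q t m theta' ds2 f = graph_run q t m theta ds2 f.
  by apply: graph_run_agree => u uds; apply: agree; apply: contraNneq nu2 => <-.
have run1 : graph_run q t m theta' (rcons ds1 s) v0 =
  at_pos a (white_op xi) base.
  rewrite graph_run_rcons /graph_step ps /= /theta' eqxx; congr (at_pos _ _ _).
  by apply: graph_run_agree => u uds; apply: agree; apply: contraNneq nu1 => <-.
rewrite !run2 run1 width_cat -/a -addnA at_pos_add -at_pos_comp.
have le : (a <= width (upper (@graph_tgt G) s))%N.
  by rewrite /upper width_cat; apply: leq_addr.
have le' : (a + n <= width (upper (@graph_tgt G) s))%N.
  by rewrite /upper ps /= !width_cat wss; apply: leq_add => //; apply: leq_addr.
have h1 := eq_from_le le (at_white (a := a) xi base).
have h2 := eq_from_le le (at_white (a := a) (at_pos (width s1 + p) (hecke q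
  false) xi) base).
have h3 := @eq_from_at_pos _ _ a n _ _ base (fun f => hecke_white q xi f cn).
rewrite (graph_run_eq q t mw theta st2 ok2 h1).
rewrite (graph_run_eq q t mw theta st2 ok2 (eq_from_le le' h3)).
by rewrite (graph_run_eq q t mw theta st2 ok2 h2).
Qed.

(* [T_+] restricted to the words that increase in each block. *)
Definition reduced_tensor (ks : seq nat) : tensor :=
  fun w => block_sum ks (fun u => Tcoef q u * (w == u)%:R).

(** Exchanging x < y inside a block multiplies the coefficient in T_+ by -q ([Tcoef_swap]) and the
    functional on the basis word by -q ([hecke_delta], [value_hecke]), hence their product by q^2.
    So [sum_blocks] applies with Q = q^2. *)
Lemma value_reduce (ks := [seq (m x.1 : nat) | x <- ss]) :
  value (Tcoef q) =
  (\prod_(k <- ks) block_fact (q ^+ 2) k) * value (reduced_tensor ks).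
Proof.
pose psi u := value (fun w => (w == u)%:R).
have sks : sumn ks = n.
  by rewrite -[RHS]wss width_edges sumnE /ks !big_map.
have -> : value (Tcoef q) = \sum_(u : (sumn ks).-tuple 'I_n) Tcoef q u * psi u.
  by rewrite value_expand sks.
rewrite (sum_blocks (Q := q ^+ 2) (f := fun u => Tcoef q u * psi u));
  last first.
- by move=> w uw; rewrite Tcoef_rep ?mul0r.
- move=> ks1 k ks2 b x y c eks le1 le2 xy sz.
  have [s1 [z [s2 [ess ek1 ek]]]] := map_eq_cat_cons eks.
  rewrite Tcoef_swap ?sz //.
  have es1 : width s1 = sumn ks1 by rewrite width_edges -ek1 sumnE !big_map;
    exact: eq_bigr.
  have pm : ((size b - sumn ks1) + 2 <= m z.1)%N by rewrite ek; lia.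
  have -> : psi (b ++ [:: y, x & c]) = - q * psi (b ++ [:: x, y & c]).
    rewrite /psi -(value_hecke _ ess pm) es1 subnKC //; apply: value_eq => w sw.
    by rewrite hecke_delta // sz sks.
  by rewrite expr2; ring.
congr (_ * _); rewrite value_expand /reduced_tensor block_sum_sum.
apply: block_sum_eq => w sw; have sw' : size w == n by rewrite sw sks.
rewrite (bigD1 (Tuple sw')) //= eqxx mulr1 big1 ?addr0 // => u nu.
case: eqP => [eu|_]; last by rewrite mulr0 mul0r.
by case/eqP: nu; apply: val_inj.
Qed.

Lemma graph_run_reduce theta' theta'' (ks := [seq (m x.1 : nat) | x <- ss]) :
  (forall u, u != u0 -> theta' u = theta u) ->
  (forall u, u != u0 -> theta'' u = theta u) ->
  theta' u0 ss = Tcoef q -> theta'' u0 ss = reduced_tensor ks ->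
  graph_run q t m theta' (ds1 ++ s :: ds2) v0 [::] =
  (\prod_(k <- ks) block_fact (q ^+ 2) k) *
    graph_run q t m theta'' (ds1 ++ s :: ds2) v0 [::].
Proof.
by move=> h' h'' e' e''; rewrite !value_run // e' e'' value_reduce.
Qed.

End WhiteVertex.
End WhiteVertices.

(** * From the strips of the split web to operators on bundles *)

Lemma sum_tuple_cast (V : nmodType) (T : finType) k l (f : seq T -> V) : k =
  l ->
  \sum_(u : k.-tuple T) f u = \sum_(u : l.-tuple T) f u.
Proof. by move=> ->. Qed.

Section WebOperators.
Context (F : fieldType) (n : nat) (q t : F).
Notation tensor := (seq 'I_n -> F).
Implicit Types (v f g : tensor) (w : seq 'I_n) (s : web_strip) (ds : seq
  web_strip).

Definition web_op (p : web_piece) : tensor -> tensor :=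
  match p with
  | Cross o => cross_op q t o
  | Cup b => cup_op q b
  | Cap b => cap_op q b
  | BlackVertex => black_op q
  | WhiteVertex => white_op (Tcoef q)
  end.

Lemma local_web_op p :
  local (size (web_src n p)) (size (web_tgt n p)) (web_op p).
Proof.
case: p => [o|b|b||] /=; rewrite ?size_nseq.
- exact: local_cross.
- exact: local_cup.
- exact: local_cap.
- exact: local_black.
- exact: local_white.
Qed.

Lemma sum_delta2 (g : 'I_n -> 'I_n -> F) a b :
  \sum_i \sum_j ((a == i) && (b == j))%:R * g i j = g a b.
Proof.
rewrite (bigD1 a) //= [X in _ + X]big1 ?addr0 => [|i ia]; last first.
  by apply: big1 => j _; rewrite eq_sym (negPf ia) mul0r.
rewrite (bigD1 b) //= big1 ?addr0 ?eqxx ?mul1r // => j jb.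
by rewrite [b == j]eq_sym (negPf jb) andbF mul0r.
Qed.

(** Links the matrix coefficients that define the trace with the closed formulas used for
    sliding. *)
Lemma web_op_sum p v w : web_op p v w =
  \sum_(u : (size (web_src n p)).-tuple 'I_n)
    piece_coef q t p u (take (size (web_tgt n p)) w)
      * v (u ++ drop (size (web_tgt n p)) w).
Proof.
case: p => [o|b|b||] /=.
- rewrite (sum_tuple2 (fun u =>
  piece_coef q t (Cross o) u (take 2 w) * v (u ++ drop 2 w))).
  case: w => [|x [|y w]] /=.
  + by rewrite /cross_op; case: o; rewrite big1 // => i _;
    rewrite big1 // => j _; rewrite mul0r.
  + by rewrite /cross_op; case: o; rewrite big1 // => i _;
    rewrite big1 // => j _; rewrite mul0r.
  rewrite take0 drop0; case: o => /=.
  + rewrite (_ : \sum_i \sum_j _ = \sum_i \sum_j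
      (((y == i) && (x == j))%:R * (t^-1 * (i != j)%:R * v [:: i, j & w])) +
      \sum_i \sum_j (((x == i) && (y == j))%:R *
        (t^-1 * (if (j < i)%N then 0 else if i == j then q else q - q^-1) * v
          [:: i, j & w]))).
      rewrite !sum_delta2 [y == x]eq_sym -val_eqE /=.
      by case: (ltngtP x y) => [?|?|/val_inj ->] /=; ring.
    rewrite -big_split; apply: eq_bigr => i _ /=; rewrite -big_split;
      apply: eq_bigr => j _ /=.
    by rewrite RcoefE [(x == j) && _]andbC mulrDl; congr (_ + _);
      rewrite [RHS]mulrCA mulrA.
  + rewrite (_ : \sum_i \sum_j _ = \sum_i \sum_j
      (((y == i) && (x == j))%:R * (t * (i != j)%:R * v [:: i, j & w])) +
      \sum_i \sum_j (((x == i) && (y == j))%:R *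
        (t * (if (i < j)%N then 0 else if i == j then q^-1 else - (q - q^-1))
          * v [:: i, j & w]))).
      rewrite !sum_delta2 [y == x]eq_sym -val_eqE /=.
      by case: (ltngtP x y) => [?|?|/val_inj ->] /=; ring.
    rewrite -big_split; apply: eq_bigr => i _ /=; rewrite -big_split;
      apply: eq_bigr => j _ /=.
    by rewrite RinvcoefE [(x == j) && _]andbC mulrDl; congr (_ + _);
      rewrite [RHS]mulrCA mulrA.
- rewrite (sum_tuple0 (fun u =>
  piece_coef q t (Cup b) u (take 2 w) * v (u ++ drop 2 w))).
  by case: b; case: w => [|x [|y w]] /=; rewrite ?take0 ?drop0 /= ?mul0r ?mul1r.
- rewrite take0 drop0 (sum_tuple2 (fun u =>
  piece_coef q t (Cap b) u [::] * v (u ++ w))).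
  rewrite /cap_op; apply: eq_bigr => i _;
    rewrite (bigD1 i) //= big1 ?addr0 => [|j ji].
    by case: b; rewrite /= eqxx ?mulr1.
  by case: b; rewrite /= eq_sym (negPf ji) ?mulr0 mul0r.
- rewrite take0 drop0 /black_op.
  exact: (sum_tuple_cast (fun u =>
    Tcoef q u * v (u ++ w)) (esym (size_nseq n false))).
- rewrite (sum_tuple0 (fun u => piece_coef q t WhiteVertex u _ * v (u ++ _))).
  by rewrite /= size_nseq.
Qed.

Lemma strip_map_op s v w : (size (lft s) <= size w)%N ->
  strip_map q t s v w = at_pos (size (lft s)) (web_op (piece s)) v w.
Proof.
case: s => l p r /= lw; rewrite -[in RHS](cat_take_drop (size l) w).
have sl : size (take (size l) w) = size l by rewrite size_takel.
rewrite -{1}sl -[size (take _ _)]addn0 at_pos_cat /at_pos web_op_sum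
  /strip_map /=.
by apply: eq_bigr => u _; rewrite drop_drop addnC.
Qed.

Definition web_run ds v : tensor :=
  foldl (fun f s => at_pos (size (lft s)) (web_op (piece s)) f) v ds.

Lemma foldl_strip_map a ds b v v' : stacked (web_src n) (web_tgt n) a ds b ->
  eq_from (size a) v v' ->
  eq_from (size b) (foldl (fun f s => strip_map q t s f) v ds) (web_run ds v').
Proof.
elim: ds a v v' => [|s ds IH] a v v' /=; first by move=> ->.
move=> [ea st] vv'; apply: (IH _ _ _ st) => w sw.
rewrite strip_map_op; last first.
  by apply: leq_trans sw; rewrite /upper size_cat leq_addr.
have := local_widen (size (rgt s)) (local_at_pos (size (lft s)) (local_web_op
  (p := piece s))).
move: sw; rewrite -ea in vv'; move: vv';
  rewrite /lower /upper !size_cat !addnA => vv' sw lo.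
exact: (local_eq lo vv').
Qed.

Lemma web_run_frame L R ds v :
  web_run [seq Strip (L ++ lft x) (piece x) (rgt x ++ R) | x <- ds] v =
  at_pos (size L) (web_run ds) v.
Proof.
elim: ds v => [|s ds IH] v /=; first by rewrite [RHS]at_pos_id.
by rewrite IH size_cat at_pos_add -at_pos_comp.
Qed.

Lemma web_run_cat ds1 ds2 v : web_run (ds1 ++ ds2) v =
  web_run ds2 (web_run ds1 v).
Proof. by rewrite /web_run foldl_cat. Qed.

Lemma web_run_column o (j a : nat) (h : nat -> seq bool) v :
  web_run [seq Strip (nseq i false) (Cross o) (h i) | i <- rev (iota j a)] v =
  at_pos j (column q t o a) v.
Proof.
elim: a v => [|a IH] v; first by rewrite [RHS]at_pos_id.
rewrite -[in LHS]addn1 iotaD rev_cat /= IH size_nseq at_pos_add.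
by rewrite -at_pos_comp.
Qed.

Lemma web_run_cross o (a b : nat) v :
  web_run (split_cross o a b) v = bundle_cross q t o a b v.
Proof.
have gen (h : nat -> seq bool) k : web_run [seq Strip (nseq i false) (Cross o)
  (h i)
    | j <- iota 0 k, i <- rev (iota j a)] v = bundle_cross q t o a k v.
  elim: k => [|k IH] //;
    rewrite -addn1 iotaD map_cat flatten_cat web_run_cat IH.
  by rewrite /= cats0 web_run_column addn1.
exact: (gen (fun i => nseq (a + b - i - 2) false)).
Qed.

Lemma web_run_cup b (a : nat) v : web_run (split_cup b a) v =
  bundle_cup q b a v.
Proof.
rewrite /split_cup; elim: a => [|a IH] //.
by rewrite -addn1 iotaD map_cat web_run_cat IH /= size_nseq addn1.
Qed.

Lemma web_run_cap b (a : nat) v : web_run (split_cap b a) v =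
  bundle_cap q b a v.
Proof.
rewrite /split_cap; elim: a v => [|a IH] v //.
by rewrite -[in LHS]addn1 iotaD rev_cat /= IH size_nseq.
Qed.

(** The recursions for bundles list the elementary pieces in the same order as [split_piece], so all
    the strips split from one strip of [D] compose to a single [graph_step]. *)
Lemma web_trace_run (G : bigraph) (D : ribbon_graph G) (m : edge G -> 'I_n.+1) :
  multiweb m ->
  web_trace n q t (split_web D m) =
  graph_run q t m (fun _ _ => Tcoef q) D (fun w => (w == [::])%:R) [::].
Proof.
move=> mw; rewrite /web_trace.
rewrite (foldl_strip_map (split_web_stacked D mw) (v' := fun w =>
  (w == [::])%:R)) //.
congr (_ [::]); rewrite /split_web.
elim: (strips D) (fun w => _) => [|s ds IH] v //=.
rewrite web_run_cat IH; congr (graph_run _ _ _ _ _ _).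
rewrite /split_strip web_run_frame /graph_step; congr (at_pos _ _ _).
apply/funext => f; case: (piece s) => [o x y|b e k|b e k|u es|u ss] /=.
- exact: web_run_cross.
- exact: web_run_cup.
- exact: web_run_cap.
- by [].
- by [].
Qed.

End WebOperators.

(** * Reduction at all white vertices *)

Lemma white_split (G : bigraph) (ds : seq (graph_strip G)) u :
  u \in pmap (@white_of G) ds ->
  exists ds1 s ss ds2, ds = ds1 ++ s :: ds2 /\ piece s = GWhite u ss.
Proof.
elim: ds => [|s ds IH] //=; case es : (white_of s) => [u'|] /=; last first.
  by move=> /IH [ds1 [s' [ss [ds2 [-> ps]]]]]; exists (s :: ds1), s', ss, ds2.
rewrite inE; case: eqP => [->|_ /= /IH [ds1 [s' [ss [ds2 [-> ps]]]]]];
  last first.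
  by exists (s :: ds1), s', ss, ds2.
move=> _; move: es; rewrite /white_of;
  case ps : (piece s) => [||||u2 ss] //= [<-].
by exists [::], s, ss, ds.
Qed.

Section Reduction.
Context (F : fieldType) (n : nat) (q t : F) (q0 : q != 0) (t0 : t != 0).
Context (G : bigraph) (m : edge G ->
  'I_n.+1) (mw : multiweb m) (D : ribbon_graph G).

(** Interpolates between T_+ everywhere and reduced tensors everywhere, so that the vertices can be
    treated one at a time. *)
Definition mixed_tensors (A : pred (wvert G)) (u : wvert G) (ss : seq (strand
  G)) :
    seq 'I_n -> F :=
  if A u then reduced_tensor q [seq (m x.1 : nat) | x <- ss] else Tcoef q.

Lemma reduce_vertex A u v : ~~ A u ->
  graph_run q t m (mixed_tensors A) D v [::] =
  (\prod_(e | white e == u) block_fact (q ^+ 2) (m e)) *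
    graph_run q t m (mixed_tensors (predU1 u A)) D v [::].
Proof.
move=> nA; have uD : u \in pmap (@white_of G) D.
  by rewrite (perm_mem (whites_once D)) mem_enum.
have [ds1 [s [ss [ds2 [eD ps]]]]] := white_split uD.
(* The vertex occurs in exactly one strip, hence in neither [ds1] nor [ds2]. *)
have := whites_once D; rewrite eD pmap_cat /= [white_of s]/white_of ps /= => pw.
have := enum_uniq (wvert G);
  rewrite -(perm_uniq pw) cat_uniq /= => /and3P[_ /norP[nu1 _] /andP[nu2 _]].
have dok := strips_ok D; have st := strips_stacked D; rewrite eD in dok st.
have := @graph_run_reduce _ _ _ _ q0 t0 _ _ mw (mixed_tensors A) u ds1 ds2 s
  ss ps dok st nu1 nu2 v
  (mixed_tensors A) (mixed_tensors (predU1 u A)).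
move=> ->; last by rewrite /mixed_tensors /= eqxx.
- congr (_ * _); have : graph_piece_ok (piece s).
    by move: dok; rewrite all_cat /= => /and3P[].
  rewrite ps /= => /andP[_ pes]; rewrite big_map.
  rewrite -(big_map (fun x : strand G => x.1) xpredT (fun e =>
    block_fact (q ^+ 2) (m e))).
  by rewrite (perm_big _ pes) big_enum.
- by [].
- by move=> u' nu; rewrite /mixed_tensors /= (negPf nu).
- by rewrite /mixed_tensors (negPf nA).
Qed.

Lemma reduce_vertices v :
  graph_run q t m (fun _ _ => Tcoef q) D v [::] =
  (\prod_e block_fact (q ^+ 2) (m e)) *
    graph_run q t m (mixed_tensors predT) D v [::].
Proof.
have main l : uniq l -> graph_run q t m (fun _ _ => Tcoef q) D v [::] =
  (\prod_(u <- l) \prod_(e | white e == u) block_fact (q ^+ 2) (m e)) *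
    graph_run q t m (mixed_tensors (mem l)) D v [::].
  elim: l => [|u l IH]; first by rewrite big_nil mul1r.
  move=> /= /andP[ul /IH ->]; rewrite big_cons (reduce_vertex (u := u)) //.
  by rewrite mulrCA mulrA.
rewrite (main _ (enum_uniq (wvert G))); congr (_ * _).
  (* Every edge has exactly one white end, so grouping by it exhausts the product over all edges. *)
  by rewrite big_enum /= [RHS](partition_big (@white G) predT).
suff -> : mixed_tensors (mem (enum (wvert G))) = mixed_tensors predT by [].
by apply/funext => u; apply/funext => ss; rewrite /mixed_tensors /= mem_enum.
Qed.

End Reduction.

(** * Quantum integers and the denominator *)

Section Qint.
Context (F : numFieldType) (q : F) (q0 : q != 0).

Lemma sum_qint j : \sum_(0 <= i < j.+1) (q ^+ 2) ^+ i = q ^+ j * qint q j.+1.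
Proof.
rewrite /qint big_add1 mulr_sumr; apply: eq_bigr => i _.
rewrite -exprM !exprnP -expfzDr //; congr (_ ^ _); lia.
Qed.

Lemma block_factE k :
  block_fact (q ^+ 2) k = q ^+ (\sum_(0 <= j < k) j) * qfact q k.
Proof.
rewrite /block_fact /qfact big_add1 expr_sum -big_split /=.
by apply: eq_bigr => j _; rewrite sum_qint.
Qed.

(** Up to a power of [q], [j+1] is the geometric sum of q^2 with j + 1 terms. It divides q^(2(j+1))
    - 1, non-zero for j + 1 >= 2 if [q] is not 1 or -1; for these two values it is the integer j +
    1, non-zero in characteristic zero. *)
Lemma qfact_neq0 n k : admissible n q -> (k <= n)%N -> qfact q k != 0.
Proof.
move=> [_ adm] kn; rewrite /qfact big_add1 big_nat prodf_seq_neq0.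
apply/allP => j; rewrite mem_index_iota => /andP[_ jk]; apply/implyP => _.
suff : q ^+ j * qint q j.+1 != 0 by rewrite mulf_eq0 negb_or => /andP[].
rewrite -sum_qint; have one : q ^+ 2 =
  1 -> \sum_(0 <= i < j.+1) (q ^+ 2) ^+ i != 0.
  move=> ->; under eq_bigr do rewrite expr1n.
  by rewrite sumr_const_nat subn0 pnatr_eq0.
case: adm => [q1|[q1|adm]]; [by apply: one; rewrite q1 expr1n|by apply: one;
  rewrite q1 sqrrN expr1n|].
case: j jk {one} => [|j] jk; first by rewrite big_nat1 expr0 oner_neq0.
have := adm j.+2; have -> : (2 <= j.+2 <= n)%N by lia.
move=> /(_ isT); rewrite exprM -subr_eq0 subrX1 mulf_eq0 negb_or => /andP[_].
by rewrite big_mkord.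
Qed.

End Qint.

(** * Laurent polynomials *)

Section Laurent.
Context (F : fieldType).
Implicit Types (f g : F -> F).

(** A Laurent polynomial is handled as a function, known only at non-zero arguments: the value at 0
    is left free. *)
Definition laurent f : Prop :=
  exists (P : {poly F}) (d : nat), forall t, t != 0 -> f t = P.[t] / t ^+ d.

Lemma laurent_cst c : laurent (fun _ => c).
Proof. by exists c%:P, 0%N => t _; rewrite hornerC divr1. Qed.

Lemma laurent_id : laurent id.
Proof. by exists 'X, 0%N => t _; rewrite hornerX divr1. Qed.

Lemma laurent_inv : laurent (fun t => t^-1).
Proof. by exists 1, 1%N => t _; rewrite hornerC div1r. Qed.

Lemma laurentD f g : laurent f -> laurent g -> laurent (fun t => f t + g t).
Proof.
move=> [P [d hP]] [Q [e hQ]]; exists (P * 'X^e + Q * 'X^d), (d + e)%N => t t0.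
rewrite hP // hQ // !hornerE exprD; field.
by rewrite !expf_neq0.
Qed.

Lemma laurentM f g : laurent f -> laurent g -> laurent (fun t => f t * g t).
Proof.
move=> [P [d hP]] [Q [e hQ]]; exists (P * Q), (d + e)%N => t t0.
by rewrite hP // hQ // hornerM exprD; field; rewrite !expf_neq0.
Qed.

Lemma laurentN f : laurent f -> laurent (fun t => - f t).
Proof.
move=> /(laurentM (laurent_cst (-1))) [P [d h]]; exists P, d => t /h <-.
by rewrite mulN1r.
Qed.

Lemma laurentX f k : laurent f -> laurent (fun t => f t ^+ k).
Proof.
move=> lf; elim: k => [|k IH]; first exact: laurent_cst.
have [P [d h]] := laurentM lf IH; exists P, d => t /h <-.
by rewrite exprS.
Qed.

Lemma laurent_sum (I : Type) (r : seq I) (A : pred I) (h : F -> I -> F) :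
  (forall i, laurent (h^~ i)) -> laurent (fun t => \sum_(i <- r | A i) h t i).
Proof.
move=> lh; elim: r => [|i r IH].
  by have [P [d e]] := laurent_cst 0; exists P, d => t /e <-; rewrite big_nil.
have [P [d e]] : laurent (fun t => (if A i then h t i else 0)
    + \sum_(j <- r | A j) h t j).
  by apply: laurentD IH; case: (A i); [exact: lh | exact: laurent_cst].
by exists P, d => t /e <-; rewrite big_cons; case: (A i); rewrite ?add0r.
Qed.

Context (n : nat).
Notation tensor := (seq 'I_n -> F).

Definition laurent_tensor (v : F -> tensor) : Prop := forall w, laurent (v^~ w).

(** This property is stable under composition, so a state sum can be treated one elementary operator
    at a time. *)
Definition laurent_op (T : F -> tensor -> tensor) : Prop :=
  forall v, laurent_tensor v -> laurent_tensor (fun t => T t (v t)).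

Lemma laurent_at_pos a (T : F -> tensor -> tensor) :
  laurent_op T -> laurent_op (fun t => at_pos a (T t)).
Proof.
move=> lT; elim: a => [|a IH] v lv w; first exact: lT.
case: w => [|x w]; first exact: lv.
by apply: (IH (fun t u => v t (x :: u))) => u; apply: lv.
Qed.

Lemma laurent_two_letter (c e d1 d2 : F -> F) :
  laurent c -> laurent e -> laurent d1 -> laurent d2 ->
  laurent_op (fun t => two_letter (c t) (e t) (d1 t) (d2 t)).
Proof.
move=> lc le l1 l2 v lv [|x [|y w]] /=; try exact: laurent_cst.
apply: laurentM lc _; case: (x == y); first exact: laurentM le (lv _).
apply: laurentD (lv _) _; case: (x < y)%N.
  exact: laurentM l1 (lv _).
exact: laurentM l2 (lv _).
Qed.

Lemma laurent_q : laurent (fun t => t ^+ n).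
Proof. exact: laurentX laurent_id. Qed.

Lemma laurent_qV : laurent (fun t => (t ^+ n)^-1).
Proof.
have [P [d h]] := laurentX n laurent_inv; exists P, d => t /h <-.
by rewrite exprVn.
Qed.

Lemma laurent_cross o : laurent_op (fun t => cross_op (t ^+ n) t o).
Proof.
have lq : laurent (fun t => t ^+ n - (t ^+ n)^-1).
  exact: laurentD laurent_q (laurentN laurent_qV).
case: o; apply: laurent_two_letter.
- exact: laurent_inv.
- exact: laurent_q.
- exact: lq.
- exact: laurent_cst.
- exact: laurent_id.
- exact: laurent_qV.
- exact: laurent_cst.
- exact: laurentN lq.
Qed.

Lemma laurent_qz z : laurent (fun t => (t ^+ n) ^ z).
Proof.
case: z => k; first exact: laurentX laurent_q.
have [P [d h]] := laurentX k.+1 laurent_qV; exists P, d => t /h <-.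
by rewrite exprVn.
Qed.

Lemma laurent_cup b : laurent_op (fun t => cup_op (t ^+ n) b).
Proof.
move=> v lv [|x [|y w]] /=; try exact: laurent_cst.
apply: laurentM (lv _); apply: laurentM (laurent_cst _).
by case: b; [exact: laurent_cst | exact: laurent_qz].
Qed.

Lemma laurent_cap b : laurent_op (fun t => cap_op (t ^+ n) b).
Proof.
move=> v lv w; apply: laurent_sum => i; apply: laurentM (lv _).
by case: b; [exact: laurent_cst | exact: laurent_qz].
Qed.

Lemma laurent_Tcoef (w : seq 'I_n) : laurent (fun t => Tcoef (t ^+ n) w).
Proof.
apply: laurent_sum => s; apply: laurentM (laurent_cst _).
exact: laurentX (laurentN laurent_q).
Qed.

Lemma laurent_block_sum ks (h : F -> tensor) :
  laurent_tensor h -> laurent (fun t => block_sum ks (h t)).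
Proof.
elim: ks h => [|k ks IH] h lh; first exact: lh.
by apply: laurent_sum => S; apply: (IH (fun t w => h t (enum S ++ w))) => u;
  apply: lh.
Qed.

Lemma laurent_reduced ks (w : seq 'I_n) :
  laurent (fun t => reduced_tensor (t ^+ n) ks w).
Proof.
apply: (laurent_block_sum _ (h := fun t u =>
  Tcoef (t ^+ n) u * (w == u)%:R)) => u.
exact: laurentM (laurent_Tcoef _) (laurent_cst _).
Qed.

Lemma laurent_column o a : laurent_op (fun t => column (t ^+ n) t o a).
Proof.
elim: a => [|a IH] v lv w; first exact: lv.
by apply: IH; apply: laurent_at_pos lv; apply: laurent_cross.
Qed.

Lemma laurent_bundle_cross o a b : laurent_op (fun t =>
  bundle_cross (t ^+ n) t o a b).
Proof.
elim: b => [|b IH] v lv; first exact: lv.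
by apply: laurent_at_pos (IH _ lv); apply: laurent_column.
Qed.

Lemma laurent_bundle_cup b a : laurent_op (fun t => bundle_cup (t ^+ n) b a).
Proof.
elim: a => [|a IH] v lv; first exact: lv.
by apply: laurent_at_pos (IH _ lv); apply: laurent_cup.
Qed.

Lemma laurent_bundle_cap b a : laurent_op (fun t => bundle_cap (t ^+ n) b a).
Proof.
elim: a => [|a IH] v lv; first exact: lv.
by apply: IH; apply: laurent_at_pos lv; apply: laurent_cap.
Qed.

Lemma laurent_graph_run (G : bigraph) (m : edge G -> 'I_n.+1)
    (theta : F -> wvert G -> seq (strand G) -> tensor) ds :
  (forall u ss, laurent_tensor (fun t => theta t u ss)) ->
  laurent_op (fun t => graph_run (t ^+ n) t m (theta t) ds).
Proof.
move=> lth; elim: ds => [|s ds IH] v lv; first exact: lv.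
apply: (IH (fun t => graph_step (t ^+ n) t m (theta t) (v t) s)).
apply: laurent_at_pos lv; case: (piece s) => [o x y|b e k|b e k|u es|u ss] /=.
- exact: laurent_bundle_cross.
- exact: laurent_bundle_cup.
- exact: laurent_bundle_cap.
- move=> f lf w; apply: laurent_sum => i; apply: laurentM (lf _).
  exact: laurent_Tcoef.
- by move=> f lf w; apply: laurentM (lf _); apply: lth.
Qed.

End Laurent.

Theorem theorem1 (R : realType) (n : nat) (n_ge1 : (1 <= n)%N)
    (G : bigraph) (D : ribbon_graph G)
    (m : edge G -> 'I_n.+1) (m_multiweb : multiweb m) :
  exists (P : {poly R[i]}) (d : nat),
    forall q t : R[i], admissible n q -> t ^+ n = q ->
      quantum_trace q t D m = P.[t] / t ^+ d.
Proof.
pose N := (\sum_(e : edge G) \sum_(0 <= j < m e) j)%N.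
pose unit_tensor (w : seq 'I_n) : R[i] := (w == [::])%:R.
(* [P] and [d] are fixed before [q] and [t] are introduced, hence serve all of them. The exponent
   [N] is the sum of m_e (m_e - 1) / 2, the power of [q] left over by [block_factE]. *)
have [P [d h]] : laurent (fun t : R[i] => (t ^+ n) ^+ N *
    graph_run (t ^+ n) t m (mixed_tensors (t ^+ n) m predT) D unit_tensor [::]).
  apply: laurentM; first exact: laurentX (laurent_q _ _).
  apply: laurent_graph_run; last by move=> w; apply: laurent_cst.
  by move=> u ss w; apply: laurent_reduced.
exists P, d => q t adm tq; have q0 : q != 0 by case: adm.
have t0 : t != 0.
  by apply: contraNneq q0 => t0; rewrite -tq t0 expr0n; case: (n) n_ge1.
rewrite -h // tq /quantum_trace web_trace_run // (reduce_vertices q0 t0) //.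
have -> : \prod_e block_fact (q ^+ 2) (m e) = q ^+ N * \prod_e qfact q (m e).
  rewrite expr_sum -big_split /=; apply: eq_bigr => e _; exact: block_factE.
(* The extracted product of the [m_e]! cancels the denominator, which is non-zero because each [m e]
   is at most [n]. *)
rewrite [X in X / _]mulrAC mulfK // prodf_seq_neq0.
by apply/allP => e _; apply/implyP => _; apply: (qfact_neq0 q0 adm); exact: leq_ord.
Qed.
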